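(* In the M/G/$\infty$ polling system with $N\geqslant2$ queues visited in the fixed cyclic order described in the context, fix a queue $i$, let $p_i=\mathbb{P}[B_i\leqslant V_i]$ and assume $p_i>0$. Let $S_i$ be the sojourn time of a customer of queue $i$, as specified in the context. Then $$\begin{aligned}\mathbb{E}[S_i]={}&\frac{\mathbb{E}[V_i]}{\mathbb{E}[C]}\,\mathbb{P}[B_i\leqslant V_i^{res}]\,\mathbb{E}[B_i\mid B_i\leqslant V_i^{res}]\\&+\frac{\mathbb{E}[V_i]}{\mathbb{E}[C]}\,\mathbb{P}[B_i>V_i^{res}]\Bigl(\mathbb{E}[V_i^{res}\mid B_i>V_i^{res}]+\mathbb{E}[N_i+1]\bigl(\mathbb{E}[C_{/i}]+\mathbb{E}[\min(B_i,V_i)]\bigr)\Bigr)\\&+\frac{\mathbb{E}[C_{/i}]}{\mathbb{E}[C]}\Bigl(\frac{\mathbb{E}[C_{/i}^2]}{2\,\mathbb{E}[C_{/i}]}+\mathbb{E}[N_i]\,\mathbb{E}[C_{/i}]+\mathbb{E}[N_i+1]\,\mathbb{E}[\min(B_i,V_i)]\Bigr),\end{aligned}$$ where $N_i$ is a geometric random variable with $\mathbb{P}[N_i=m]=(1-p_i)^m p_i$ for integers $m\geqslant0$, and $C$, $C_{/i}$, $V_i^{res}$ are as defined in the context, with $V_i^{res}$ independent of $B_i$ and $V_i$ independent of $B_i$.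
   Context: The system has $N\geqslant2$ infinite-buffer queues attended in cyclic order $1,2,\ldots,N$ by a single group of infinitely many servers moving together. Customers arrive at queue $i$ according to a Poisson process with rate $\lambda_i$; the arrival processes are independent. The servers stay at queue $i$ for a random visit time $V_i>0$, during which queue $i$ works as an M/G/$\infty$ queue: customers present when the servers enter start service at that moment and customers arriving during the visit start service on arrival. Service times at queue $i$ are i.i.d. copies of $B_i$; customers completing service leave the system; a customer whose service is not completed by the end of the visit stays and receives at the next visit a fresh independent service time distributed as $B_i$. After the visit to queue $i$ the servers need a switch-over time $D_i\geqslant0$ before entering the next queue. All arrival processes, visit times, service times and switch-over times are mutually independent, with finite second moments of the $V_k$ and $D_k$. Notation: $C=\sum_{k=1}^N(V_k+D_k)$ is the cycle time and $C_{/i}=C-V_i$ (the cycle time except the visit to queue $i$). $V_i^{res}$ and $C_{/i}^{res}$ are the residual times, with distributions $\mathbb{P}[V_i^{res}\leqslant x]=\frac1{\mathbb{E}[V_i]}\int_0^x\mathbb{P}[V_i>y]\,\mathrm{d}y$ and $\mathbb{P}[C_{/i}^{res}\leqslant x]=\frac1{\mathbb{E}[C_{/i}]}\int_0^x\mathbb{P}[C_{/i}>y]\,\mathrm{d}y$. A second index $m$ denotes independent copies: $(B_{i,m})_{m\geqslant0}$, $(V_{i,m})_{m\geqslant1}$, $(C_{/i,m})_{m\geqslant1}$ are independent i.i.d. sequences distributed as $B_i$, $V_i$, $C_{/i}$, all independent of a copy $V_{i,0}^{res}$ of $V_i^{res}$ and of $C_{/i}^{res}$; $C_m=C_{/i,m}+V_{i,m}$;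 and $N_i+1=\inf\{k\geqslant1: B_{i,k}\leqslant V_{i,k}\}$, so that $\mathbb{P}[N_i=m]=(1-p_i)^mp_i$. Sojourn time of a customer arriving at queue $i$: the customer arrives during a visit of the servers to queue $i$ with probability $\mathbb{E}[V_i]/\mathbb{E}[C]$ and outside such a visit with probability $\mathbb{E}[C_{/i}]/\mathbb{E}[C]$, independently of all the variables above, and $$S_i=\begin{cases}B_{i,0}, & \text{arrival during a visit to queue } i \text{ and } B_{i,0}\leqslant V_{i,0}^{res},\\ V_{i,0}^{res}+\sum_{m=1}^{N_i}C_m+C_{/i,N_i+1}+B_{i,N_i+1}, & \text{arrival during a visit to queue } i \text{ and } B_{i,0}>V_{i,0}^{res},\\ C_{/i}^{res}+\sum_{m=1}^{N_i}C_m+B_{i,N_i+1}, & \text{arrival outside the visits to queue } i.\end{cases}$$ A product of a probability with an expectation conditional on the corresponding event is interpreted as $0$ if the event has probability $0$. *)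

(* Defs.v *)
From HB Require Import structures.
From mathcomp Require Import all_boot all_order all_algebra.
From mathcomp Require Import all_classical all_reals all_analysis.
From mathcomp Require Import measurable_realfun.

Set Implicit Arguments.
Unset Strict Implicit.
Unset Printing Implicit Defensive.

Import Order.TTheory GRing.Theory Num.Theory.
Import numFieldNormedType.Exports.

Local Open Scope classical_set_scope.
Local Open Scope ring_scope.

Section probability_notions.
Context d (T : measurableType d) (R : realType) (P : probability T R).

(* Product rule over every finite subfamily; the injection f enumerates the
   indices of the subfamily. *)
Definition mutually_independent (I : Type) (X : I -> T -> R) : Prop :=
  forall (n : nat) (f : 'I_n -> I) (E : 'I_n -> set R),
    injective f -> (forall j, measurable (E j)) ->
    P (\bigcap_(j in [set: 'I_n]) (X (f j) @^-1` E j)) =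
    (\prod_(j < n) P (X (f j) @^-1` E j))%E.

Definition independent2 (X Y : T -> R) : Prop :=
  mutually_independent (fun b : bool => if b then X else Y).

Definition same_law (X Y : {RV P >-> R}) : Prop :=
  forall E : set R, measurable E -> distribution P X E = distribution P Y E.

(* P[Y <= x] = 1 / E[X] * int_0^x P[X > y] dy for x >= 0; at x = 0 this forces
   Y > 0 almost surely, so the law of Y is determined. *)
Definition residual_time (X Y : {RV P >-> R}) : Prop :=
  forall x : R, 0 <= x ->
    cdf Y x = (('E_P[X])^-1 *
               \int[lebesgue_measure]_(y in `[0%R, x]) ccdf X y)%E.

(* E[X | A] = E[X 1_A] / P[A].  If P[A] = 0 the product P[A] * e vanishes for
   every extended real e. *)
Definition cond_expectation (X : T -> R) (A : set T) : \bar R :=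
  ((\int[P]_(w in A) (X w)%:E) / P A)%E.

End probability_notions.

Notation "''E_' P [ X | A ]" := (cond_expectation P X A)
  (at level 5, P, X, A at level 4, format "''E_' P [ X  |  A ]") : ereal_scope.

Inductive system_index (N : nat) : Type :=
| Interarrival of 'I_N & nat
| Visit of 'I_N
| Switchover of 'I_N
| Service of 'I_N.

(* Queues are numbered 0, ..., N-1.  The Poisson arrival process of queue k is
   given by its i.i.d. exponential interarrival times. *)
Record polling_system d (T : measurableType d) (R : realType)
    (P : probability T R) (N : nat) := PollingSystem {
  arrival_rate : 'I_N -> R;
  interarrival : 'I_N -> nat -> {RV P >-> R};
  visit : 'I_N -> {RV P >-> R};
  switchover : 'I_N -> {RV P >-> R};
  service : 'I_N -> {RV P >-> R};
  arrival_rate_gt0 : forall k, 0 < arrival_rate k;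
  interarrival_law : forall k n (E : set R), measurable E ->
    distribution P (interarrival k n) E = exponential_prob (arrival_rate k) E;
  visit_gt0 : forall k, {ae P, forall w, 0 < visit k w};
  switchover_ge0 : forall k, {ae P, forall w, 0 <= switchover k w};
  service_ge0 : forall k, {ae P, forall w, 0 <= service k w};
  visit_moment2 : forall k, ('E_P[fun w => (visit k w ^+ 2)%R] < +oo)%E;
  switchover_moment2 : forall k,
    ('E_P[fun w => (switchover k w ^+ 2)%R] < +oo)%E;
  system_independent : mutually_independent P (fun j : system_index N =>
    match j return T -> R with
    | Interarrival k n => interarrival k n
    | Visit k => visit k
    | Switchover k => switchover k
    | Service k => service k
    end) }.

Section cycle.
Context d (T : measurableType d) (R : realType) (P : probability T R) (N : nat).
Variables (Q : polling_system P N) (i : 'I_N).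

Definition cycle_time (w : T) : R :=
  \sum_(k < N) (visit Q k w + switchover Q k w).

Lemma measurable_cycle_time : measurable_fun [set: T] cycle_time.
Proof. by apply: measurable_sum => k; apply: measurable_funD. Qed.

HB.instance Definition _ :=
  isMeasurableFun.Build _ _ T R cycle_time measurable_cycle_time.

(* C_{/i} *)
Definition cycle_time_except (w : T) : R := cycle_time w - visit Q i w.

Lemma measurable_cycle_time_except : measurable_fun [set: T] cycle_time_except.
Proof. by apply: measurable_funB. Qed.

HB.instance Definition _ :=
  isMeasurableFun.Build _ _ T R cycle_time_except measurable_cycle_time_except.

(* p_i *)
Definition completion_prob : \bar R :=
  P [set w | service Q i w <= visit Q i w].

End cycle.

Inductive customer_index : Type :=
| ServiceCopy of nat
| VisitCopy of nat
| CycleCopy of nat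
| ResidualVisit
| ResidualCycle
| ArrivalDuringVisit.

(* visit_copy and cycle_copy are indexed from 1: their terms of index 0 are
   unconstrained and unused. *)
Record tagged_customer d (T : measurableType d) (R : realType)
    (P : probability T R) (N : nat) (Q : polling_system P N) (i : 'I_N) :=
  TaggedCustomer {
  service_copy : nat -> {RV P >-> R};
  visit_copy : nat -> {RV P >-> R};
  cycle_copy : nat -> {RV P >-> R};
  residual_visit : {RV P >-> R};
  residual_cycle : {RV P >-> R};
  during_visit : set T;
  service_copy_law : forall m, same_law (service_copy m) (service Q i);
  visit_copy_law : forall m, (0 < m)%N -> same_law (visit_copy m) (visit Q i);
  cycle_copy_law : forall m, (0 < m)%N ->
    same_law (cycle_copy m) (cycle_time_except Q i);
  residual_visit_law : residual_time (visit Q i) residual_visit;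
  residual_cycle_law : residual_time (cycle_time_except Q i) residual_cycle;
  measurable_during_visit : measurable during_visit;
  during_visit_prob :
    P during_visit = ('E_P[visit Q i] / 'E_P[cycle_time Q])%E;
  outside_visit_prob :
    P (~` during_visit) =
      ('E_P[cycle_time_except Q i] / 'E_P[cycle_time Q])%E;
  customer_independent : mutually_independent P (fun j : customer_index =>
    match j return T -> R with
    | ServiceCopy m => service_copy m
    | VisitCopy m => visit_copy m.+1
    | CycleCopy m => cycle_copy m.+1
    | ResidualVisit => residual_visit
    | ResidualCycle => residual_cycle
    | ArrivalDuringVisit => \1_during_visit
    end) }.

Section sojourn.
Context d (T : measurableType d) (R : realType) (P : probability T R) (N : nat).
Context (Q : polling_system P N) (i : 'I_N).
Variable c : tagged_customer Q i.

(* N_i + 1 = inf {k >= 1 : B_{i,k} <= V_{i,k}}; the value 1 taken when this set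
   is empty is a dummy, that event being null if p_i > 0. *)
Definition completion_visit (w : T) : nat :=
  match pselect (exists k : nat,
      (0 < k)%N && (service_copy c k w <= visit_copy c k w)) with
  | left h => ex_minn h
  | right _ => 1%N
  end.

Definition failed_visits (w : T) : nat := (completion_visit w).-1.

Definition sojourn_time (w : T) : R :=
  let n := failed_visits w in
  let full_cycles :=
    \sum_(1 <= m < n.+1) (cycle_copy c m w + visit_copy c m w) in
  if w \in during_visit c then
    if service_copy c 0 w <= residual_visit c w then service_copy c 0 w
    else residual_visit c w + full_cycles
         + cycle_copy c n.+1 w + service_copy c n.+1 w
  else residual_cycle c w + full_cycles + service_copy c n.+1 w.

End sojourn.

(* Main.v *)
Require Import Defs.
From HB Require Import structures.
From mathcomp Require Import all_boot all_order all_algebra.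
From mathcomp Require Import all_classical all_reals all_analysis.
From mathcomp Require Import measurable_realfun.

(** Write A_k for the event that the services started in visits 1, ..., k all
    fail.  A failed service occupies the whole visit and a successful one only
    its service time, so visit m contributes min(B_m, V_m) in both cases, and
    the random sums in S_i become series such as
    sum_k 1_{A_k} (C_{/i,k+1} + min(B_{k+1}, V_{k+1})).  The event A_k is
    independent of the variables of index k + 1 and of those describing the
    arrival, whence the expectation of such a series is the product of
    sum_k P[A_k] = E[N_i + 1] with the expectation of one term.  The mean
    residual time E[X^2] / (2 E[X]) comes from the tail formula and Tonelli. *)

Set Implicit Arguments.
Unset Strict Implicit.
Unset Printing Implicit Defensive.

Import Order.TTheory GRing.Theory Num.Theory.
Import numFieldNormedType.Exports.

Local Open Scope classical_set_scope.
Local Open Scope ring_scope.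
Local Open Scope ereal_scope.

(** * Independence of blocks of variables *)

(** Two gaps between hypotheses and tools shape the argument. Times are nonnegative only almost
    surely, while Tonelli and termwise integration are applied to functions nonnegative everywhere:
    auxiliary integrands therefore carry absolute values, removed by almost sure equality, and
    expectations stay in [0, +oo]. Independence is a product rule for single variables, while A_k
    involves several: hence the lift to sigma-algebras of disjoint blocks. The minimum avoids
    conditional laws: B_m given success and V_m given failure are biased, but min(B_m, V_m) is
    independent of A_{m-1}. A customer interrupted in the visit of arrival waits through N_i + 1
    full absences of the servers; one arriving outside a visit waits through N_i, after a residual
    one. This is the shift between A_k and A_{k+1}. *)

Section pi_system_independence.
Context d (T : measurableType d) (R : realType) (P : probability T R).

(** For fixed [E], both sides are finite measures in [F]; they agree on a pi-system containing the
    whole space, hence on the sigma-algebra it generates. *)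
Lemma independent_g_sigma_algebra (G : set (set T)) (E : set T) :
    measurable E -> G `<=` measurable -> setI_closed G -> G setT ->
    (forall F, G F -> P (E `&` F) = P E * P F) ->
  forall F, <<s G >> F -> P (E `&` F) = P E * P F.
Proof.
move=> mE mG GI GT GE F sGF.
have finE : P E \is a fin_num by rewrite fin_num_measure.
pose k : {nonneg R} := NngNum (fine_ge0 (measure_ge0 P E)).
have kE : k%:num%:E = P E by rewrite /= fineK.
have : mrestr P mE F = mscale k P F.
  apply: (g_sigma_algebra_measure_unique G mG (fun=> setT)) sGF => //.
  - by apply/seteqP; split => // x _; exists 0%N.
  - move=> A GA; transitivity (P E * P A); last by rewrite -kE.
    by rewrite /= /mrestr setIC GE.
  - move=> _; rewrite -[ltLHS]/(P (setT `&` E)) setTI.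
    by rewrite -ge0_fin_numE.
by move=> msF; transitivity (mscale k P F); [rewrite -msF /mrestr setIC|rewrite -kE].
Qed.

End pi_system_independence.

Section block_independence.
Context d (T : measurableType d) (R : realType) (P : probability T R).
Context (I : Type) (X : I -> T -> R).
Hypothesis mX : forall j, measurable_fun setT (X j).
Hypothesis indX : mutually_independent P X.

(** A pi-system generating the sigma-algebra of the variables [X j], [j] in [A]. The list may
    contain repetitions; [{classic I}] supplies the decidable equality for membership. *)
Definition cylinder (A : set I) : set (set T) :=
  [set F | exists (s : seq {classic I}) (E : I -> set R),
    [/\ {in s, forall j, A j}, forall j, measurable (E j) &
        F = \bigcap_(j in [set` s]) X j @^-1` E j]].

Lemma cylinder_measurable A : cylinder A `<=` measurable.
Proof.
move=> _ [s [E [_ mE ->]]].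
rewrite bigcap_seq; apply: bigsetI_measurable => j _.
by rewrite -[X in measurable X]setTI; exact: mX.
Qed.

Lemma cylinderT A : cylinder A setT.
Proof.
exists [::], (fun=> setT); split=> //.
by apply/seteqP; split.
Qed.

Lemma cylinder_preimage (A : set I) j (E : set R) :
  A j -> measurable E -> cylinder A (X j @^-1` E).
Proof.
move=> Aj mE; exists [:: j : {classic I}], (fun=> E); split=> //.
  by move=> k; rewrite inE => /eqP ->.
by rewrite bigcap_seq big_seq1.
Qed.

Lemma cylinder_setI A A' F F' : cylinder A F -> cylinder A' F' ->
  cylinder (A `|` A') (F `&` F').
Proof.
move=> [s [E [sA mE ->]]] [s' [E' [sA' mE' ->]]].
(* Off its own list each family is relaxed to [setT], so that an index of one list alone receives no
   constraint from the other. *)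
pose on (r : seq {classic I}) (G : I -> set R) j :=
  if (j : {classic I}) \in r then G j else setT.
exists (s ++ s'), (fun j => on s E j `&` on s' E' j); split.
- move=> j; rewrite mem_cat => /orP[js|js]; [left; exact: sA|right; exact: sA'].
- by move=> j; apply: measurableI; rewrite /on; case: ifP.
apply/seteqP; split=> w.
  move=> [sw sw'] j _; split; rewrite /on; case: ifPn => // jr.
  - exact: sw.
  - exact: sw'.
move=> sw; split=> j /= jr.
  by have [] := sw j; rewrite /= ?mem_cat ?jr//= /on jr.
by have [] := sw j; rewrite /= ?mem_cat ?jr ?orbT//= /on jr.
Qed.

Lemma cylinder_setI_closed A : setI_closed (cylinder A).
Proof. by move=> F F' AF AF'; rewrite -(setUid A); exact: cylinder_setI. Qed.

(** Enumerating a duplicate-free list is an injection from ordinals, the form in which the product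
    rule is assumed. *)
Lemma independent_seq (s : seq {classic I}) (E : I -> set R) :
    uniq s -> (forall j, measurable (E j)) ->
  P (\bigcap_(j in [set` s]) X j @^-1` E j) = \prod_(j <- s) P (X j @^-1` E j).
Proof.
move=> us mE.
have inj : injective (tnth (in_tuple s)) by exact/tuple_uniqP.
rewrite big_tnth.
have <- := @indX (size s) (tnth (in_tuple s)) (fun k => E (tnth (in_tuple s) k)) inj (fun=> mE _).
congr (P _); apply/seteqP; split => w sw j /=.
  by move=> _; apply: sw; rewrite /= mem_tnth.
move=> js; have /tnthP[k ->] : (j : {classic I}) \in in_tuple s by [].
exact: sw.
Qed.

Lemma independent_cylinder A A' F F' : A `&` A' = set0 ->
  cylinder A F -> cylinder A' F' -> P (F `&` F') = P F * P F'.
Proof.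
move=> AA' [s [E [sA mE ->]]] [s' [E' [sA' mE' ->]]].
(* A repeated index only repeats its constraint; the product rule needs duplicate-free lists. *)
have undupE (r : seq {classic I}) (G : I -> set R) : \bigcap_(j in [set` r]) X j @^-1` G j =
    \bigcap_(j in [set` undup r]) X j @^-1` G j.
  by apply/seteqP; split=> w rw j jr; apply: rw; move: jr; rewrite /= mem_undup.
rewrite (undupE s) (undupE s').
move: (undup s) (undup s') (undup_uniq s) (undup_uniq s')
  (mem_undup s) (mem_undup s') => r r' ur ur' rs rs'.
have disj j : j \in r -> j \in r' -> False.
  rewrite rs rs' => /sA Aj /sA' A'j.
  by suff : (A `&` A') j by rewrite AA'.
(* One family has to serve both lists; as they are disjoint, preferring [E] on [r] leaves [E']
   intact on [r']. *)
pose G j := if (j : {classic I}) \in r then E j else E' j.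
have GE : {in r, forall j, G j = E j} by move=> j jr; rewrite /G jr.
have GE' : {in r', forall j, G j = E' j}.
  by move=> j jr; rewrite /G; case: ifPn => // /disj -/(_ jr).
have mG j : measurable (G j) by rewrite /G; case: ifP.
transitivity (P (\bigcap_(j in [set` r ++ r']) X j @^-1` G j)).
  congr (P _); apply/seteqP; split => w.
    move=> [rw rw'] j; rewrite /= mem_cat => /orP[jr|jr].
      by rewrite GE//; exact: rw.
    by rewrite GE'//; exact: rw'.
  move=> rw; split=> j /= jr.
    by rewrite -GE//; apply: rw; rewrite /= mem_cat jr.
  by rewrite -GE'//; apply: rw; rewrite /= mem_cat jr orbT.
rewrite independent_seq//; last first.
  rewrite cat_uniq ur ur' andbT/=; apply/hasPn => j jr'.
  by apply/negP => /disj; exact.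
rewrite !independent_seq//. rewrite big_cat; congr (_ * _); apply: eq_big_seq => j jr.
  by rewrite GE.
by rewrite GE'.
Qed.

(** The pi-system argument is used twice: with [F] fixed it reduces [F'] to a cylinder [G], then
    with [G] fixed it reduces [F] to a cylinder. *)
Theorem independent_blocks (A A' : set I) (F F' : set T) : A `&` A' = set0 ->
  <<s cylinder A >> F -> <<s cylinder A' >> F' -> P (F `&` F') = P F * P F'.
Proof.
move=> AA' sF sF'.
have msig B : <<s cylinder B >> `<=` measurable.
  apply: smallest_sub; first exact: sigma_algebra_measurable.
  exact: cylinder_measurable.
apply: (@independent_g_sigma_algebra _ _ _ _ (cylinder A')) => //.
- exact: msig sF.
- exact: cylinder_measurable.
- exact: cylinder_setI_closed.
- exact: cylinderT.
move=> G cG; rewrite setIC muleC.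
apply: (@independent_g_sigma_algebra _ _ _ _ (cylinder A)) sF => //.
- exact: cylinder_measurable cG.
- exact: cylinder_measurable.
- exact: cylinder_setI_closed.
- exact: cylinderT.
by move=> H cH; apply: (@independent_cylinder A' A) => //; rewrite setIC.
Qed.

(** Measurability here refers to the sigma-algebra of the block, so that events built from several
    of its variables are seen to lie in the block. *)
Lemma measurable_block (A : set I) j : A j ->
  measurable_fun setT (X j : g_sigma_algebraType (cylinder A) -> R).
Proof.
move=> Aj _ E mE; rewrite setTI; apply: sub_sigma_algebra.
exact: cylinder_preimage.
Qed.

Lemma sub_block (A A' : set I) : A `<=` A' ->
  <<s cylinder A >> `<=` <<s cylinder A' >>.
Proof.
move=> AA'; apply: sub_sigma_algebra2.
move=> F [s [E [sA mE ->]]].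
by exists s, E; split=> // j /sA /AA'.
Qed.

End block_independence.

(** * Expectations of independent variables *)

Section expectation_independence.
Context d (T : measurableType d) (R : realType) (P : probability T R).

Lemma ge0_integral_independent (F : set T) (U : T -> R) :
    measurable F -> measurable_fun setT U -> (forall w, 0 <= U w)%R ->
    (forall E : set R, measurable E -> P (F `&` U @^-1` E) = P F * P (U @^-1` E)) ->
  \int[P]_(w in F) (U w)%:E = P F * \int[P]_w (U w)%:E.
Proof.
move=> mF mU U0 indU.
pose V := (U \_ F)%R.
have mV : measurable_fun setT V.
  apply/(measurable_restrictT U mF); exact: measurable_funTS mU.
(* Restriction to [F] sends the mass outside [F] to 0, so the law of [V] is a multiple of that of
   [U] only away from 0; the point 0 contributes nothing to the integral of the identity. *)
pose D : set R := `]0%R, +oo[%classic.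
have tail (W : T -> R) : measurable_fun setT W -> (forall w, 0 <= W w)%R ->
    \int[P]_w (W w)%:E = \int[pushforward P W]_(y in D) y%:E.
  move=> mW W0; rewrite ge0_integral_pushforward//=.
  - rewrite [RHS]integral_mkcond; apply: eq_integral => w _.
    rewrite patchE; case: ifPn => //; rewrite notin_setE /D/= in_itv/= andbT => /negP.
    by rewrite -leNgt => W0'; congr EFin; apply/eqP; rewrite eq_le W0' W0.
  - exact: measurable_itv.
  - by move=> y; rewrite inE /D/= in_itv/= andbT lee_fin => /ltW.
have finF : P F \is a fin_num by rewrite fin_num_measure.
pose k : {nonneg R} := NngNum (fine_ge0 (measure_ge0 P F)).
have kE : k%:num%:E = P F by rewrite /= fineK.
rewrite integral_mkcond.
transitivity (\int[P]_w (V w)%:E).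
  by apply: eq_integral => w _; rewrite /V !patchE; case: ifP.
rewrite (tail V mV); last by move=> w; rewrite /V patchE; case: ifP.
rewrite (tail U mU U0) -kE -ge0_integral_mscale//=; first last.
- by move=> y; rewrite /D/= in_itv/= andbT lee_fin => /ltW.
- exact: measurable_itv.
apply: eq_measure_integral => A mA AD.
transitivity (P F * P (U @^-1` A)); last by rewrite -kE.
rewrite -indU//; congr (P _); apply/seteqP; split=> w /=.
  rewrite /V patchE; case: ifPn => [/set_mem//|_ /AD].
  by rewrite /D/= in_itv/= ltxx.
by move=> [Fw]; rewrite /V patchE mem_set.
Qed.

(* Wald's identity: A k is the event that the k-th term is not yet stopped. *)
Lemma integral_stopped_sum (F : set T) (A : nat -> set T) (U : nat -> T -> R)
    (u : \bar R) :
    measurable F -> (forall k, measurable (A k)) ->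
    (forall k, measurable_fun setT (U k)) -> (forall k w, 0 <= U k w)%R ->
    (forall k (E : set R), measurable E ->
       P (F `&` A k `&` U k @^-1` E) = P F * P (A k) * P (U k @^-1` E)) ->
    (forall k, \int[P]_w (U k w)%:E = u) ->
  \int[P]_(w in F) (\sum_(k <oo) (\1_(A k) w * U k w)%:E) =
    P F * ((\sum_(k <oo) P (A k)) * u).
Proof.
move=> mF mA mU U0 ind uE.
have u0 : 0 <= u by rewrite -(uE 0%N); apply: integral_ge0 => w _; rewrite lee_fin.
have m1 k : measurable_fun setT (fun w => (\1_(A k) w * U k w)%:E : \bar R).
  by apply/measurable_EFinP; apply: measurable_funM => //; exact: measurable_indic.
have finF : P F \is a fin_num by rewrite fin_num_measure.
rewrite integral_nneseries//; first last.
- by move=> k w _; rewrite lee_fin mulr_ge0.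
- by move=> k; apply: measurable_funTS.
transitivity (\sum_(k <oo) (P F * (P (A k) * u))).
  apply: eq_eseriesr => k _.
  transitivity (\int[P]_(w in F `&` A k) (U k w)%:E).
    rewrite [LHS]integral_mkcond [RHS]integral_mkcond; apply: eq_integral => w _.
    rewrite !patchE in_setI indicE; case: (w \in F) => //=.
    by case: (w \in A k); rewrite ?mul1r ?mul0r.
  have FA : P (F `&` A k) = P F * P (A k).
    by have := ind k setT measurableT; rewrite preimage_setT setIT probability_setT mule1.
  rewrite (ge0_integral_independent (measurableI _ _ mF (mA k)) (mU k) (U0 k)).
    by rewrite FA uE muleA.
  by move=> E mE; rewrite ind// FA.
rewrite -(fineK finF) nneseriesZl; last by move=> k _; exact: mule_ge0.
congr (_ * _); rewrite muleC.
have [ufin|] := boolP (u \is a fin_num).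
  rewrite -(fineK ufin) -nneseriesZl//.
  by apply: eq_eseriesr => k _; rewrite muleC.
rewrite ge0_fin_numE// -leNgt leye_eq => /eqP ->.
(* Here [u = +oo]: either all [A k] are null and both sides are 0, or one term is infinite and both
   sides are [+oo]. *)
have [A0|/existsNP[k /eqP Ak0]] := pselect (forall k, P (A k) = 0).
  rewrite !eseries0 ?mule0// => k _ _; by rewrite A0 ?mul0e.
rewrite [RHS]gt0_mulye; last first.
  apply: (lt_le_trans _ (nneseries_lim_ge k.+1 _)) => //=.
  apply: (@lt_le_trans _ _ (P (A k))); first by rewrite lt0e Ak0/=.
  by rewrite big_mkord (bigD1 ord_max)//= leeDl// sume_ge0.
apply/eqP; rewrite -leye_eq.
apply: (le_trans _ (nneseries_lim_ge k.+1 _)) => //=; last first.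
  by move=> j _ _; exact: mule_ge0.
rewrite big_mkord (bigD1 ord_max)//= gt0_muley ?lt0e ?Ak0 ?measure_ge0//.
by rewrite leeDl// sume_ge0// => j _; exact: mule_ge0.
Qed.

(** Independence makes each joint law the product of its marginals, and product measures are unique.
    This lets the customer's copies be exchanged for the variables of the system. *)
Lemma eq_joint_law (X1 Y1 X2 Y2 : {RV P >-> R}) (h : R * R -> \bar R) :
    same_law X1 X2 -> same_law Y1 Y2 ->
    (forall A B : set R, measurable A -> measurable B ->
      P (X1 @^-1` A `&` Y1 @^-1` B) = P (X1 @^-1` A) * P (Y1 @^-1` B)) ->
    (forall A B : set R, measurable A -> measurable B ->
      P (X2 @^-1` A `&` Y2 @^-1` B) = P (X2 @^-1` A) * P (Y2 @^-1` B)) ->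
    measurable_fun setT h -> (forall z, 0 <= h z) ->
  \int[P]_w h (X1 w, Y1 w) = \int[P]_w h (X2 w, Y2 w).
Proof.
move=> XX YY ind1 ind2 mh h0.
have mXY (X Y : {RV P >-> R}) : measurable_fun setT (fun w => (X w, Y w)).
  exact: measurable_fun_pair.
pose XY1 : {mfun T >-> (R * R)%type} := HB.pack (fun w => (X1 w, Y1 w))
  (isMeasurableFun.Build _ _ _ _ _ (mXY X1 Y1)).
pose XY2 : {mfun T >-> (R * R)%type} := HB.pack (fun w => (X2 w, Y2 w))
  (isMeasurableFun.Build _ _ _ _ _ (mXY X2 Y2)).
have -> : \int[P]_w h (X1 w, Y1 w) = \int[distribution P XY1]_z h z.
  by rewrite ge0_integral_distribution.
have -> : \int[P]_w h (X2 w, Y2 w) = \int[distribution P XY2]_z h z.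
  by rewrite ge0_integral_distribution.
apply: eq_measure_integral => S mS _.
transitivity ((distribution P X2 \x distribution P Y2) S).
  apply/esym; move: S mS; apply: product_measure_unique => A B mA mB.
  transitivity (distribution P X2 A * distribution P Y2 B) => //.
  by rewrite -XX// -YY//; exact: ind1.
by move: S mS; apply: product_measure_unique => A B mA mB; exact: ind2.
Qed.

Lemma same_law_integral (X Y : {RV P >-> R}) (h : R -> \bar R) :
    same_law X Y -> measurable_fun setT h -> (forall x, 0 <= h x) ->
  \int[P]_w h (X w) = \int[P]_w h (Y w).
Proof.
move=> XY mh h0.
have -> : \int[P]_w h (X w) = \int[distribution P X]_z h z.
  by rewrite ge0_integral_distribution.
have -> : \int[P]_w h (Y w) = \int[distribution P Y]_z h z.
  by rewrite ge0_integral_distribution.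
by apply: eq_measure_integral => S mS _; exact: XY.
Qed.

End expectation_independence.

(** * Residual times *)

Section residual_time.
Context d (T : measurableType d) (R : realType) (P : probability T R).
Let mu : {measure set (measurableTypeR R) -> \bar R} := @lebesgue_measure R.

(** The rays []a, +oo[] are stable under intersection and generate the Borel sets; their
    probabilities are [1 - cdf]. *)
Lemma same_law_cdf (X Y : {RV P >-> R}) : cdf X =1 cdf Y -> same_law X Y.
Proof.
move=> XY A mA.
apply: (measure_unique (@RGenOInfty.G R) (fun n => `](- n%:R)%R, +oo[%classic)).
- exact: RGenOInfty.measurableE.
- move=> _ _ [a ->] [b ->]; exists (Num.max a b).
  by apply/seteqP; split=> x /=; rewrite !in_itv/= !andbT gt_max => /andP.
- by move=> n; eexists.
- apply/seteqP; split=> // x _; exists (Num.bound `|x|) => //=.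
  rewrite in_itv/= andbT ltrNl (le_lt_trans (ler_norm _))// normrN.
  by rewrite archi_boundP.
- move=> _ [a ->]; rewrite -[LHS]/(ccdf X a) -[RHS]/(ccdf Y a).
  by rewrite !ccdf_1_cdf XY.
- move=> k; apply: (@le_lt_trans _ _ 1); last exact: ltry.
  exact: (probability_le1 (distribution P X)).
- by [].
Qed.

Lemma integral_id_itv (a : R) : (0 <= a)%R ->
  \int[mu]_(y in `[0%R, a[) y%:E = (a ^+ 2 / 2)%:E.
Proof.
rewrite le_eqVlt => /predU1P[<-|a0].
  by rewrite set_itvco0 integral_set0 expr0n/= mul0r.
rewrite integral_itv_bndo_bndc; last exact: measurable_funTS.
rewrite (@continuous_FTC2 _ id (fun x => x ^+ 2 / 2)%R)//=.
- by rewrite expr0n/= mul0r sube0.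
- by apply: continuous_subspaceT => x; exact: cvg_id.
- split.
  + by move=> x _; exact: ex_derive.
  + apply: cvg_at_right_filter; apply: cvgM; last exact: cvg_cst.
    exact: exprn_continuous.
  + apply: cvg_at_left_filter; apply: cvgM; last exact: cvg_cst.
    exact: exprn_continuous.
- move=> x _; rewrite derive1E derive_val/= /GRing.scale/=.
  by rewrite !mulr0 add0r !mulr1 mulrDr !(mulrC _ x) -splitr.
Qed.

(** * Tail formulas for the first two moments *)

Lemma measurable_strip d' (T' : measurableType d') (f : T' -> R) :
  measurable_fun setT f ->
  measurable [set z : measurableTypeR R * T' | (0 <= z.1)%R && (z.1 < f z.2)%R].
Proof.
move=> mf.
pose b1 (z : measurableTypeR R * T') := (0 <= z.1)%R.
pose b2 (z : measurableTypeR R * T') := (z.1 < f z.2)%R.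
have m1 : measurable_fun setT b1 by exact: measurable_fun_ler.
have m2 : measurable_fun setT b2.
  by apply: measurable_fun_ltr => //; exact: measurableT_comp.
have := measurable_and m1 m2 measurableT (Y := [set true]).
by rewrite setTI; exact.
Qed.

(* Tonelli on the strip 0 <= x < f w. *)
Lemma integral_strip d' (T' : measurableType d')
    (nu : {sigma_finite_measure set T' -> \bar R}) (f : T' -> R)
    (g : measurableTypeR R -> \bar R) (h : T' -> \bar R) :
    measurable_fun setT f -> measurable_fun setT g -> measurable_fun setT h ->
    (forall x, 0 <= g x) -> (forall w, 0 <= h w) ->
  \int[mu]_(x in `[0%R, +oo[) (g x * \int[nu]_(w in [set w | (x < f w)%R]) h w) =
  \int[nu]_w (h w * \int[mu]_(x in `[0%R, f w[) g x).
Proof.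
move=> mf mg mh g0 h0.
pose S := [set z : measurableTypeR R * T' | (0 <= z.1)%R && (z.1 < f z.2)%R].
have mS : measurable S by exact: measurable_strip.
pose F z : \bar R := (\1_S z)%:E * (g z.1 * h z.2).
have mF : measurable_fun setT F.
  apply: emeasurable_funM; first by apply/measurable_EFinP; exact: measurable_indic.
  by apply: emeasurable_funM; exact: measurableT_comp.
have F0 z : 0 <= F z by rewrite mule_ge0// ?lee_fin// mule_ge0.
have mset x : measurable [set w | (x < f w)%R].
  have := @measurable_fun_ltr _ _ _ setT (cst x) f _ mf measurableT [set true].
  by rewrite setTI; apply.
have memE (U : Type) (b : pred U) u : (u \in [set v | b v]) = b u.
  by apply/idP/idP; rewrite inE.
have FE x w : F (x, w) = if ((0 <= x) && (x < f w))%R then g x * h w else 0.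
  by rewrite /F indicE/= /S (memE _ (fun z => (0 <= z.1)%R && (z.1 < f z.2)%R))/=; case: ifP; rewrite ?mul1e ?mul0e.
have -> : \int[mu]_(x in `[0%R, +oo[) (g x * \int[nu]_(w in [set w | (x < f w)%R]) h w) =
    \int[mu]_x \int[nu]_w F (x, w).
  rewrite integral_mkcond; apply: eq_integral => x _.
  rewrite patchE; case: ifPn => [|]; rewrite ?notin_setE ?inE/= in_itv/= andbT => x0.
    rewrite integral_mkcond -ge0_integralZl//; first last.
    - by move=> w _; rewrite patchE; case: ifP.
    - by apply/(measurable_restrictT h (mset x)); exact: measurable_funTS.
    apply: eq_integral => w _; rewrite FE patchE (memE _ (fun w => (x < f w)%R)) x0/=.
    by case: ifP; rewrite ?mule0.
  rewrite [RHS]integral0_eq// => w _; rewrite FE.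
  by move/negP/negbTE : x0 => ->.
rewrite (fubini_tonelli F)//; apply: eq_integral => w _.
rewrite [in RHS]integral_mkcond -ge0_integralZl//; first last.
- by move=> x _; rewrite patchE; case: ifP.
- by apply/(measurable_restrictT g (measurable_itv _)); exact: measurable_funTS.
apply: eq_integral => x _; rewrite FE patchE mem_setE in_itv/=.
by case: ifP; rewrite ?mule0// muleC.
Qed.

(** The maximum covers the empty interval when [a < 0], a case that occurs only on a null set in the
    application to [X]. *)
Lemma integral_cst1_itv (a : R) : \int[mu]_(x in `[0%R, a[) 1 = (Num.max a 0)%:E.
Proof.
rewrite integral_cst//= mul1e /mu lebesgue_measure_itv/= lte_fin.
by case: ltP => a0; rewrite ?sube0// [RHS]/EFin.
Qed.

Lemma ccdfE (X : {RV P >-> R}) r :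
  ccdf X r = \int[P]_(w in [set w | (r < X w)%R]) 1.
Proof.
have -> : [set w | (r < X w)%R] = X @^-1` `]r, +oo[.
  by apply/seteqP; split=> w /=; rewrite in_itv/= andbT.
by rewrite integral_cst ?mul1e//; exact: measurable_funPTI.
Qed.

Lemma ae_ge0_expectation_ccdf (X : {RV P >-> R}) :
    {ae P, forall w, (0 <= X w)%R} ->
  'E_P[X] = \int[mu]_(r in `[0%R, +oo[) ccdf X r.
Proof.
move=> X0.
transitivity (\int[mu]_(r in `[0%R, +oo[)
    (1 * \int[P]_(w in [set w | (r < X w)%R]) 1)).
  rewrite (@integral_strip _ _ P X (cst 1) (cst 1))//.
  rewrite unlock; apply: ae_eq_integral => //.
  - exact/measurable_EFinP.
  - apply: (eq_measurable_fun (fun w => (Num.max (X w) 0)%:E)) => [w _|].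
      by rewrite mul1e integral_cst1_itv.
    by apply/measurable_EFinP; exact: measurable_maxr.
  - apply: filterS X0 => w X0 _.
    by rewrite mul1e integral_cst1_itv max_l.
by apply: eq_integral => r _; rewrite mul1e -ccdfE.
Qed.

(** Comes from X^2 / 2 = int_0^X r dr; the absolute value of [r], harmless on the half-line, makes
    the weight nonnegative everywhere. *)
Lemma ae_ge0_second_moment_ccdf (X : {RV P >-> R}) :
    {ae P, forall w, (0 <= X w)%R} ->
  'E_P[fun w => (X w ^+ 2)%R] = 2%:E * \int[mu]_(r in `[0%R, +oo[) (`|r|%:E * ccdf X r).
Proof.
move=> X0.
have -> : \int[mu]_(r in `[0%R, +oo[) (`|r|%:E * ccdf X r) = \int[mu]_(r in `[0%R, +oo[)
    (`|r|%:E * \int[P]_(w in [set w | (r < X w)%R]) 1).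
  by apply: eq_integral => r _; rewrite -ccdfE.
rewrite (@integral_strip _ _ P X (fun r => `|r|%:E) (cst 1))//; last first.
  by apply/measurable_EFinP; exact: normr_measurable.
have sqE w : 1 * \int[mu]_(r in `[0%R, X w[) `|r|%:E = (Num.max (X w) 0 ^+ 2 / 2)%:E.
  rewrite mul1e.
  have -> : \int[mu]_(r in `[0%R, X w[) `|r|%:E = \int[mu]_(r in `[0%R, X w[) r%:E.
    by apply: eq_integral => r; rewrite inE/= in_itv/= => /andP[r0 _]; rewrite ger0_norm.
  have [Xw0|Xw0] := leP 0%R (X w); first by rewrite integral_id_itv.
  by rewrite set_itv_ge ?bnd_simp -?leNgt ?ltW// integral_set0 expr0n/= mul0r.
have mS : measurable_fun setT (fun w => (Num.max (X w) 0 ^+ 2 / 2)%R : R).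
  apply: measurable_funM => //; apply: measurable_funX; exact: measurable_maxr.
under eq_integral do rewrite sqE.
rewrite -ge0_integralZl//; first last.
- by move=> w _; rewrite lee_fin divr_ge0 ?sqr_ge0.
- exact/measurable_EFinP.
rewrite unlock; apply: ae_eq_integral => //.
- by apply/measurable_EFinP; exact: measurable_funX.
- by apply: emeasurable_funM => //; exact/measurable_EFinP.
- apply: filterS X0 => w X0 _.
  by rewrite max_l// -EFinM mulrC divfK// pnatr_eq0.
Qed.

(** The strip with Lebesgue measure in both coordinates and [f = id]: a point y >= 0 is counted for
    the x in [0, y[, a set of length y. *)
Lemma integral_tail_strip (g : measurableTypeR R -> \bar R) :
    measurable_fun setT g -> (forall x, 0 <= g x) ->
  \int[mu]_(x in `[0%R, +oo[) \int[mu]_(y in `]x, +oo[) g y =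
  \int[mu]_(y in `[0%R, +oo[) (`|y|%:E * g y).
Proof.
move=> mg g0.
transitivity (\int[mu]_(x in `[0%R, +oo[) (1 * \int[mu]_(y in [set y | (x < y)%R]) g y)).
  by apply: eq_integral => x _; rewrite mul1e set_itvoy.
rewrite (@integral_strip _ _ (@lebesgue_measure R) id (cst 1) g)//.
rewrite [RHS]integral_mkcond; apply: eq_integral => y _.
rewrite integral_cst1_itv patchE; case: ifPn.
  by rewrite inE/= in_itv/= andbT => y0; rewrite muleC max_l// ger0_norm.
rewrite notin_setE/= in_itv/= andbT => /negP; rewrite -ltNge => y0.
by rewrite max_r ?ltW// mule0.
Qed.

(** * Law and mean of a residual time *)

Variables X Y : {RV P >-> R}.
Hypothesis XY : residual_time X Y.

Lemma cdf_residual_time0 : cdf Y 0 = 0.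
Proof. by rewrite XY// set_itv1 integral_set1 mule0. Qed.

Lemma residual_time_gt0 : {ae P, forall w, (0 < Y w)%R}.
Proof.
exists (Y @^-1` `]-oo, 0%R]); split.
- exact: measurable_funPTI.
- exact: cdf_residual_time0.
- by move=> w/= /negP; rewrite in_itv/= -leNgt.
Qed.

Hypothesis X0 : {ae P, forall w, (0 <= X w)%R}.

Let m := 'E_P[X].

Let mE : m = \int[mu]_(r in `[0%R, +oo[) ccdf X r.
Proof. exact: ae_ge0_expectation_ccdf. Qed.

Let mG : measurable_fun setT (ccdf X : measurableTypeR R -> \bar R).
Proof. exact: ccdf_measurable. Qed.

Let m_ge0 : 0 <= m.
Proof. by rewrite mE; exact: integral_ge0. Qed.

(** Follows from the mere existence of [Y]: with mean 0 or [+oo] the defining formula would make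
    [cdf Y] vanish on the half-line, against its limit 1. *)
Lemma residual_time_mean_neq0y : (m != 0) && (m != +oo).
Proof.
suff : ~ forall r, (0 <= r)%R -> cdf Y r = 0.
  move=> nz; apply/andP; split; apply/eqP => m0; apply: nz => r r0; rewrite XY// -/m m0.
    rewrite [X in _ * X](_ : _ = 0) ?mule0//; apply/eqP.
    rewrite eq_le integral_ge0 ?andbT//.
    rewrite -m0 mE; apply: ge0_subset_integral => //.
    - exact: measurable_funTS.
    - by move=> x/=; rewrite !in_itv/= => /andP[->].
  by rewrite invey mul0e.
move=> cdf0.
have : cdf Y @ +oo%R --> (0 : \bar R).
  apply: cvg_near_cst; near=> r; apply: cdf0.
  by near: r; exact: nbhs_pinfty_ge.
move=> /(cvg_unique _ (cvg_cdfy1 Y)) => /(_ (@ereal_hausdorff R))/eqP.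
by rewrite onee_eq0.
Unshelve. all: by end_near. Qed.

Lemma ccdf_residual_time r : (0 <= r)%R ->
  m * ccdf Y r = \int[mu]_(y in `]r, +oo[) ccdf X y.
Proof.
move=> r0; have /andP[mN0 mNy] := residual_time_mean_neq0y.
have mfin : m \is a fin_num by rewrite ge0_fin_numE// lt_neqAle mNy leey.
rewrite ccdf_1_cdf XY// -/m muleBr// mule1 muleA divee// mul1e.
have g0 (D : set (measurableTypeR R)) : 0 <= \int[mu]_(y in D) ccdf X y by exact: integral_ge0.
have split_m : m = \int[mu]_(y in `[0%R, r]) ccdf X y + \int[mu]_(y in `]r, +oo[) ccdf X y.
  rewrite mE -ge0_integral_setU//.
  - congr (integral _ _ _); apply/seteqP; split=> y /=; rewrite !in_itv/= !andbT.
      by move=> ->; case: (leP y r) => _; [left|right].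
    by move=> [/andP[]//|/ltW]; exact: le_trans.
  - exact: measurable_funTS.
  - rewrite disj_set2E; apply/eqP/seteqP; split=> // y [] /=.
    by rewrite !in_itv/= andbT => /andP[_ /le_lt_trans] /[apply]; rewrite ltxx.
rewrite {1}split_m addeAC subee ?add0e//.
rewrite ge0_fin_numE//; apply: (@le_lt_trans _ _ m); last by rewrite -ge0_fin_numE.
by rewrite split_m leeDl.
Qed.

(** E[X] E[Y] = int_0^oo int_x^oo P[X > y] dy dx = int_0^oo y P[X > y] dy = E[X^2] / 2, and E[X] is
    nonzero and finite. *)
Theorem residual_time_expectation :
  'E_P[Y] = 'E_P[fun w => (X w ^+ 2)%R] / (2%:E * 'E_P[X]).
Proof.
have /andP[mN0 mNy] := residual_time_mean_neq0y.
have mfin : m \is a fin_num by rewrite ge0_fin_numE// lt_neqAle mNy leey.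
have -> : 'E_P[fun w => (X w ^+ 2)%R] = 2%:E * (m * 'E_P[Y]).
  rewrite ae_ge0_second_moment_ccdf//; congr (_ * _).
  rewrite ae_ge0_expectation_ccdf; last by apply: filterS residual_time_gt0 => w /ltW.
  rewrite -ge0_integralZl//; last by apply: measurable_funTS; exact: (ccdf_measurable Y).
  rewrite -integral_tail_strip//; apply: eq_integral => r.
  by rewrite inE/= in_itv/= andbT => r0; rewrite ccdf_residual_time.
rewrite -/m [X in X / _]muleA (muleAC (2 * m)) divee ?mul1e//.
- by rewrite fin_numM.
- by rewrite mule_neq0 ?mN0// eqe pnatr_eq0.
Qed.

End residual_time.

(** The definition constrains the distribution function only for x >= 0; below 0 it vanishes by
    monotonicity, its value at 0 being 0. *)
Lemma residual_time_same_law d (T : measurableType d) (R : realType)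
    (P : probability T R) (X Y Y' : {RV P >-> R}) :
  residual_time X Y -> residual_time X Y' -> same_law Y Y'.
Proof.
move=> XY XY'; apply: same_law_cdf => r.
have [r0|r0] := leP 0%R r; first by rewrite XY// XY'.
have cdf0 (Z : {RV P >-> R}) : residual_time X Z -> cdf Z r = 0.
  move=> XZ; apply/eqP; rewrite eq_le cdf_ge0 andbT.
  by rewrite -(cdf_residual_time0 XZ) cdf_nondecreasing// ltW.
by rewrite !cdf0.
Qed.

(** * The tagged customer *)

Section auxiliary.
Context d (T : measurableType d) (R : realType) (P : probability T R).

Lemma block_pair (I : Type) (X : I -> T -> R) (A : set I) j k (S : set (R * R)) :
  A j -> A k -> measurable S ->
  <<s cylinder X A >> ((fun w => (X j w, X k w)) @^-1` S).
Proof.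
move=> Aj Ak mS.
have mj := @measurable_block _ _ _ _ X A j Aj.
have mk := @measurable_block _ _ _ _ X A k Ak.
have := measurable_fun_pair mj mk measurableT mS.
by rewrite setTI.
Qed.

Lemma independent_pair (I : Type) (X : I -> T -> R) j k (E F : set R) :
    mutually_independent P X -> j <> k -> measurable E -> measurable F ->
  P (X j @^-1` E `&` X k @^-1` F) = P (X j @^-1` E) * P (X k @^-1` F).
Proof.
move=> indX jk mE mF.
apply: (@independent_cylinder _ _ _ _ _ X indX [set j] [set k]).
- by rewrite -subset0 => l [/= -> /jk].
- exact: cylinder_preimage.
- exact: cylinder_preimage.
Qed.

Lemma same_law_ae (X Y : {RV P >-> R}) (E : set R) :
    same_law X Y -> measurable E -> {ae P, forall w, E (Y w)} ->
  {ae P, forall w, E (X w)}.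
Proof.
move=> XY mE [M [mM M0 EM]].
have mXE : measurable (X @^-1` (~` E)) by apply: measurable_funPTI; exact: measurableC.
have mYE : measurable (Y @^-1` (~` E)) by apply: measurable_funPTI; exact: measurableC.
exists (X @^-1` (~` E)); split=> //.
transitivity (P (Y @^-1` (~` E))); first by apply: XY; exact: measurableC.
exact: (subset_measure0 mYE mM EM M0).
Qed.

(** If [P A = 0], both sides are 0, whatever the quotient: the convention for conditioning on a null
    event. *)
Lemma mule_cond_expectation (X : T -> R) (A : set T) :
    measurable A -> measurable_fun setT X ->
  P A * 'E_P[X | A] = \int[P]_(w in A) (X w)%:E.
Proof.
move=> mA mX; rewrite /cond_expectation.
have [PA0|PA0] := eqVneq (P A) 0.
  rewrite PA0 mul0e; apply/esym/null_set_integral => //.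
  by apply: measurable_funTS; exact/measurable_EFinP.
rewrite muleCA divee ?mule1//; exact: fin_num_measure.
Qed.

Lemma measurable_fun_nat_index (n : T -> nat) (f : nat -> T -> R) :
    (forall k, measurable [set w | n w = k]) ->
    (forall k, measurable_fun setT (f k)) ->
  measurable_fun setT (fun w => f (n w) w).
Proof.
move=> mn mf _ E mE; rewrite setTI.
rewrite (_ : _ @^-1` _ = \bigcup_k ([set w | n w = k] `&` f k @^-1` E)).
  apply: bigcupT_measurable => k; apply: measurableI => //.
  by rewrite -[X in measurable X]setTI; exact: mf.
apply/seteqP; split=> w /=; first by move=> Ew; exists (n w).
by move=> [k _ [/= <-]].
Qed.

Lemma nneseries_eq_sum (f : nat -> \bar R) n :
    (forall k, 0 <= f k) -> (forall k, (n <= k)%N -> f k = 0) ->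
  \sum_(k <oo) f k = \sum_(k < n) f k.
Proof.
move=> f0 fn; rewrite (nneseries_split 0 n)// add0n eseries0 ?adde0 ?big_mkord//.
by move=> k nk _; exact: fn.
Qed.

Lemma ae_forall_nat (p : nat -> T -> Prop) :
  (forall k, {ae P, forall w, p k w}) -> {ae P, forall w, forall k, p k w}.
Proof.
move=> hp; have := negligible_bigcup hp.
by apply: negligibleS => w /= /existsNP[k nk]; exists k.
Qed.

Lemma measurable_indic_sum (A : nat -> set T) (u : nat -> T -> R) :
    (forall k, measurable (A k)) -> (forall k, measurable_fun setT (u k)) ->
    (forall k w, 0 <= u k w)%R ->
  measurable_fun setT (fun w => \sum_(k <oo) (\1_(A k) w * u k w)%:E).
Proof.
move=> mA mu u0; apply: ge0_emeasurable_sum => [k w _ _|k _].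
  by rewrite lee_fin mulr_ge0.
by apply/measurable_EFinP; apply: measurable_funM => //; exact: measurable_indic.
Qed.

Lemma integral_indic_sum (A : nat -> set T) : (forall k, measurable (A k)) ->
  \int[P]_w (\sum_(k <oo) (\1_(A k) w * 1)%:E) = \sum_(k <oo) P (A k).
Proof.
move=> mA; rewrite integral_nneseries//.
  apply: eq_eseriesr => k _.
  under eq_integral do rewrite mulr1.
  by rewrite integral_indic// setIT.
by move=> k; apply/measurable_EFinP; exact: measurable_funM.
Qed.

Lemma ae_expectation_norm (Z : T -> R) : measurable_fun setT Z ->
  {ae P, forall w, (0 <= Z w)%R} -> \int[P]_w `|Z w|%:E = 'E_P[Z].
Proof.
move=> mZ Z0; rewrite unlock; apply: ae_eq_integral => //.
- by apply/measurable_EFinP; exact: measurableT_comp.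
- exact/measurable_EFinP.
- by apply: filterS Z0 => w Z0 _; rewrite ger0_norm.
Qed.

Lemma measurable_norm_EFin : measurable_fun setT (fun x : R => `|x|%:E).
Proof. by apply/measurable_EFinP; exact: normr_measurable. Qed.

Lemma measurable_in (A : set T) : measurable A -> measurable_fun setT (fun w => w \in A).
Proof. by move=> mA; apply: (measurable_fun_bool true); rewrite setTI preimage_mem_true. Qed.

Lemma integral_mul_indic (A G : set T) (f : T -> R) :
  \int[P]_(w in A) (f w * \1_G w)%:E = \int[P]_(w in A `&` G) (f w)%:E.
Proof.
rewrite [RHS]integral_mkcondr; apply: eq_integral => w _.
by rewrite patchE indicE; case: (w \in G); rewrite ?mulr1 ?mulr0.
Qed.

Lemma ae_integral_norm (A : set T) (Z : {RV P >-> R}) : measurable A ->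
  {ae P, forall w, (0 <= Z w)%R} ->
  \int[P]_(w in A) `|Z w|%:E = \int[P]_(w in A) (Z w)%:E.
Proof.
move=> mA Z0; apply: ae_eq_integral => //.
- by apply: measurable_funTS; apply/measurable_EFinP; exact: measurableT_comp.
- by apply: measurable_funTS; exact/measurable_EFinP.
- by apply: filterS Z0 => w Z0 _; rewrite ger0_norm.
Qed.

End auxiliary.

(** * Waiting events and their probabilities *)

Section tagged_customer.
Context d (T : measurableType d) (R : realType) (P : probability T R) (N : nat).
Context (Q : polling_system P N) (i : 'I_N) (c : tagged_customer Q i).

Let X (j : customer_index) : T -> R :=
  match j return T -> R with
  | ServiceCopy m => service_copy c m
  | VisitCopy m => visit_copy c m.+1
  | CycleCopy m => cycle_copy c m.+1
  | ResidualVisit => residual_visit c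
  | ResidualCycle => residual_cycle c
  | ArrivalDuringVisit => \1_(during_visit c)
  end.

Let mX j : measurable_fun setT (X j).
Proof. by case: j => //=; exact: measurable_indic (measurable_during_visit c). Qed.

Let indX : mutually_independent P X.
Proof. exact: customer_independent. Qed.

Local Notation block A := <<s cylinder X A >>.

(* Visits and services of the customer are numbered from 1: success k concerns
   the service started in visit k + 1, while VisitCopy k is the index of the
   length of that visit. *)
Definition success (k : nat) : set T :=
  [set w | (service_copy c k.+1 w <= visit_copy c k.+1 w)%R].

(** The event A_k of the overview; A_0 is the whole space. *)
Definition still_waiting (k : nat) : set T := \bigcap_(j < k) ~` success j.

(** The variables that decide A_k. [VisitCopy l] already stands for visit l + 1, hence a shift for
    services only; service 0, begun on arrival, is left out. *)
Definition customer_visits (k : nat) : set customer_index :=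
  [set j | exists2 l, (l < k)%N & j = ServiceCopy l.+1 \/ j = VisitCopy l].

Let le_set : set (R * R) := [set z | (z.1 <= z.2)%R].

Let m_le : measurable le_set.
Proof.
have := @measurable_fun_ler _ (R * R)%type R setT fst snd measurable_fst measurable_snd measurableT [set true].
by rewrite setTI; apply.
Qed.

Lemma block_success (A : set customer_index) k :
  A (ServiceCopy k.+1) -> A (VisitCopy k) -> block A (success k).
Proof. by move=> A1 A2; have := @block_pair _ _ _ _ X A _ _ le_set A1 A2 m_le. Qed.

Lemma block_setI (A : set customer_index) F G :
  block A F -> block A G -> block A (F `&` G).
Proof. exact: (@measurableI _ (g_sigma_algebraType (cylinder X A))). Qed.

Lemma block_setC (A : set customer_index) F : block A F -> block A (~` F).
Proof. exact: (@measurableC _ (g_sigma_algebraType (cylinder X A))). Qed.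

Lemma still_waitingS k : still_waiting k.+1 = still_waiting k `&` ~` success k.
Proof. by rewrite /still_waiting !bigcap_mkord big_ord_recr. Qed.

Lemma block_still_waiting (A : set customer_index) k :
  customer_visits k `<=` A -> block A (still_waiting k).
Proof.
elim: k => [|k IH] kA.
  rewrite /still_waiting bigcap_mkord big_ord0.
  exact: (@measurableT _ (g_sigma_algebraType (cylinder X A))).
rewrite still_waitingS; apply: block_setI.
  by apply: IH => j [l lk jl]; apply: kA; exists l => //; exact: ltnW.
by apply: block_setC; apply: block_success; apply: kA; exists k => //; [left|right].
Qed.

(** The arrival event enters the independent family through its indicator and is recovered as the
    preimage of 1. *)
Lemma block_during_visit (A : set customer_index) :
  A ArrivalDuringVisit -> block A (during_visit c).
Proof.
move=> AA; have := @cylinder_preimage _ _ _ _ X A _ [set 1%R] AA (measurable_set1 _).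
rewrite (_ : _ @^-1` _ = during_visit c); first exact: sub_sigma_algebra.
apply/seteqP; split=> w /=; rewrite indicE.
  by case: (boolP (w \in _)) => [/set_mem//|_ /eqP]; rewrite eq_sym oner_eq0.
by move=> Dw; rewrite mem_set.
Qed.

Lemma block_measurable A F : block A F -> measurable F.
Proof.
apply: (@smallest_sub _ _ _ measurable); first exact: sigma_algebra_measurable.
exact: cylinder_measurable.
Qed.

Lemma measurable_success k : measurable (success k).
Proof. by apply: (@block_measurable setT); exact: block_success. Qed.

Lemma measurable_still_waiting k : measurable (still_waiting k).
Proof. by apply: (@block_measurable setT); exact: block_still_waiting. Qed.

Lemma service_visit_copy_law k (h : R * R -> \bar R) :
    measurable_fun setT h -> (forall z, 0 <= h z) ->
  \int[P]_w h (service_copy c k.+1 w, visit_copy c k.+1 w) =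
  \int[P]_w h (service Q i w, visit Q i w).
Proof.
move=> mh h0; apply: eq_joint_law => //.
- exact: service_copy_law.
- exact: visit_copy_law.
- by move=> A B; apply: (independent_pair indX (j := ServiceCopy k.+1) (k := VisitCopy k)).
- by move=> A B; apply: (independent_pair (system_independent Q) (j := Service i) (k := Visit i)).
Qed.

(** Puts a probability in the form of an integral over a pair, to which the transfer of joint laws
    applies. *)
Lemma prob_le (f g : T -> R) : measurable_fun setT f -> measurable_fun setT g ->
  P [set w | (f w <= g w)%R] = \int[P]_w (\1_le_set (f w, g w))%:E.
Proof.
move=> mf mg; have mfg := measurable_fun_pair mf mg measurableT m_le.
rewrite setTI in mfg; rewrite -[in LHS](setIT [set w | _]) -(integral_indic P measurableT mfg).
by apply: eq_integral.
Qed.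

Lemma prob_success k : P (success k) = completion_prob Q i.
Proof.
rewrite /success /completion_prob !prob_le//.
apply: (service_visit_copy_law k (h := fun z => (\1_le_set z)%:E)) => //.
exact/measurable_EFinP/measurable_indic.
Qed.

(** A_k concerns visits 1, ..., k and [success k] concerns visit k + 1, so each further failure
    contributes an independent factor 1 - p_i. *)
Lemma prob_still_waiting k : P (still_waiting k) = (1 - completion_prob Q i) ^+ k.
Proof.
elim: k => [|k IH].
  by rewrite /still_waiting bigcap_mkord big_ord0 probability_setT.
rewrite still_waitingS expeS muleC -IH.
rewrite (@independent_blocks _ _ _ _ _ X mX indX (customer_visits k) [set ServiceCopy k.+1; VisitCopy k]).
- by rewrite probability_setC ?prob_success//; exact: measurable_success.
- rewrite -subset0 => j [[l lk jl] /= [|] jk]; subst j; case: jl => // -[lk'].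
    by rewrite lk' ltnn in lk.
  by rewrite lk' ltnn in lk.
- exact: block_still_waiting.
- by apply: block_setC; apply: block_success; [left|right].
Qed.

(** * Number of failed visits *)

Definition never_served : set T := \bigcap_k ~` success k.

Lemma measurable_never_served : measurable never_served.
Proof. by apply: bigcapT_measurable => k; exact: measurableC (measurable_success k). Qed.

Lemma success_or_never w :
  never_served w \/ exists2 n, still_waiting n w & success n w.
Proof.
have [[n sn]|nex] := pselect (exists n, success n w); last first.
  by left=> k _ sk; apply: nex; exists k.
right; have ex : exists n, (service_copy c n.+1 w <= visit_copy c n.+1 w)%R by exists n.
by case: (ex_minnP ex) => k sk kmin; exists k => // j jk /kmin; rewrite leqNgt jk.
Qed.

(** [completion_visit] counts from 1 and [success] from 0; the predecessor in [failed_visits]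
    reconciles them. *)
Lemma failed_visits_success n w :
  still_waiting n w -> success n w -> failed_visits c w = n.
Proof.
move=> wn sn; rewrite /failed_visits /completion_visit.
case: pselect => [h|]; last by case; exists n.+1.
case: ex_minnP => m /andP[m0 sm] mmin.
have : (m <= n.+1)%N by exact: mmin.
case: m m0 sm {mmin} => // m _ sm; rewrite ltnS leq_eqVlt => /predU1P[//|mn].
by have := wn m mn.
Qed.

Lemma failed_visits_never w : never_served w -> failed_visits c w = 0%N.
Proof.
move=> nw; rewrite /failed_visits /completion_visit.
case: pselect => [[[//|k] /= sk]|//].
by have := nw k Logic.I.
Qed.

(** The extra piece at [m = 0] stems from the dummy value 1 of [completion_visit] on paths without
    success. *)
Lemma failed_visitsE m : [set w | failed_visits c w = m] =
  (still_waiting m `&` success m) `|` (if m == 0%N then never_served else set0).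
Proof.
apply/seteqP; split=> w /=.
  have [nw|[n wn sn]] := success_or_never w.
    by rewrite failed_visits_never// => <-; right.
  by rewrite (failed_visits_success wn sn) => <-; left.
move=> [[wm sm]|]; first exact: failed_visits_success.
by case: eqP => // -> ; exact: failed_visits_never.
Qed.

Lemma measurable_failed_visits m : measurable [set w | failed_visits c w = m].
Proof.
rewrite failed_visitsE; apply: measurableU.
  by apply: measurableI; [exact: measurable_still_waiting|exact: measurable_success].
by case: ifP => // _; exact: measurable_never_served.
Qed.

Definition visit_number k : set customer_index :=
  [set ServiceCopy k.+1; VisitCopy k].

Definition on_arrival : set customer_index :=
  [set j | j = ArrivalDuringVisit \/ j = ServiceCopy 0 \/ j = ResidualVisit \/ j = ResidualCycle].

Lemma disjoint_visit_number k :
  (on_arrival `|` customer_visits k) `&` visit_number k = set0.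
Proof.
rewrite -subset0 => j [jk vj]; case: vj jk => /= -> [|[l lk]].
- by move=> /= [|[|[|]]].
- by move=> [[kl]|//]; rewrite kl ltnn in lk.
- by move=> /= [|[|[|]]].
- by move=> [//|[kl]]; rewrite kl ltnn in lk.
Qed.

(** No waiting event involves a cycle copy, so [k] and [l] are unrelated; the pairs [k, k] and
    [k.+1, k] both occur later. *)
Lemma disjoint_cycle k l :
  (on_arrival `|` customer_visits k) `&` [set CycleCopy l] = set0.
Proof.
by rewrite -subset0 => j [jk /= je]; move: jk; rewrite je => -[/= [|[|[|]]]|[? _ []]].
Qed.

Lemma disjoint_on_arrival k : on_arrival `&` customer_visits k = set0.
Proof.
by rewrite -subset0 => j [+ [l lk jl]]; case: jl => ->; move=> /= [|[|[|]]].
Qed.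

(** Block independence used twice: arrival and past visits together against [A], then against each
    other. *)
Lemma independent_arrival_visits k (A : set customer_index) F G H :
    (on_arrival `|` customer_visits k) `&` A = set0 ->
    block on_arrival F -> block (customer_visits k) G -> block A H ->
  P (F `&` G `&` H) = P F * P G * P H.
Proof.
move=> dA bF bG bH.
rewrite (independent_blocks mX indX dA)//; last first.
  by apply: block_setI; [apply: sub_block bF|apply: sub_block bG]; [left|right].
by rewrite (independent_blocks mX indX (disjoint_on_arrival k)).
Qed.

Lemma blockT A : block A setT.
Proof. exact: (@measurableT _ (g_sigma_algebraType (cylinder X A))). Qed.

Hypothesis hp : 0 < completion_prob Q i.

(** The event lies in every A_k, and P[A_k] = (1 - p_i)^k tends to 0 by [hp]. *)
Lemma prob_never_served : P never_served = 0.
Proof.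
have finp : completion_prob Q i \is a fin_num.
  by rewrite -(prob_success 0) fin_num_measure//; exact: measurable_success.
have p1 : completion_prob Q i <= 1.
  by rewrite -(prob_success 0) probability_le1//; exact: measurable_success.
have finn : P never_served \is a fin_num.
  by rewrite fin_num_measure//; exact: measurable_never_served.
set q := (1 - fine (completion_prob Q i))%R.
have q1 : (`|q| < 1)%R.
  have : (0 < fine (completion_prob Q i) <= 1)%R.
    by rewrite -!lee_fin -!lte_fin fineK ?hp.
  by move=> /andP[p0 p1']; rewrite ger0_norm ?subr_ge0// ltrBlDr ltrDl.
have le_q k : (fine (P never_served) <= q ^+ k)%R.
  rewrite -lee_fin fineK// EFin_expe EFinB fineK// -prob_still_waiting.
  apply: le_measure; rewrite ?inE.
  - exact: measurable_never_served.
  - exact: measurable_still_waiting.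
  - by move=> w nw j _; exact: nw.
apply/eqP; rewrite -[P _]fineK// eqe eq_le fine_ge0// andbT leNgt.
apply/negP => P0.
have /cvgrPdist_lt/(_ _ P0) := cvg_expr q1.
case=> k _ /(_ k (leqnn k))/=; rewrite sub0r normrN => /lt_le_trans -/(_ _ (le_trans (le_q k) (ler_norm _))).
by rewrite ltxx.
Qed.

Lemma ae_served : {ae P, forall w, exists2 n, still_waiting n w & success n w}.
Proof.
exists never_served; split; [exact: measurable_never_served|exact: prob_never_served|].
by move=> w /=; have [//|] := success_or_never w.
Qed.

Theorem prob_failed_visits m : P [set w | failed_visits c w = m] =
  (1 - completion_prob Q i) ^+ m * completion_prob Q i.
Proof.
rewrite failed_visitsE measureU0//.
- have bs : block (visit_number m) (success m) by apply: block_success; [left|right].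
  have bw : block (customer_visits m) (still_waiting m) by exact: block_still_waiting.
  (* The whole space serves as arrival event, which leaves the visits up to [m] and visit [m.+1]. *)
  have := independent_arrival_visits (@disjoint_visit_number m) (@blockT on_arrival) bw bs.
  by rewrite setTI probability_setT mul1e prob_still_waiting prob_success.
- by apply: measurableI; [exact: measurable_still_waiting|exact: measurable_success].
- by case: ifP => // _; exact: measurable_never_served.
- by case: ifP => // _; exact: prob_never_served.
Qed.

Lemma still_waiting_indic n w k :
  still_waiting n w -> success n w -> \1_(still_waiting k) w = (k <= n)%N%:R :> R.
Proof.
move=> wn sn; rewrite indicE; congr (_%:R); case: leqP => kn.
  by rewrite mem_set// => j jk; apply: wn; exact: leq_trans kn.
by rewrite memNset// => wk; exact: (wk n).
Qed.

(** The indicators cut the series after the first success: a sum of random length becomes a series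
    that can be integrated term by term. *)
Lemma sum_still_waiting n w (u : nat -> R) :
    still_waiting n w -> success n w -> (forall k, 0 <= u k)%R ->
  \sum_(k <oo) (\1_(still_waiting k) w * u k)%:E = (\sum_(k < n.+1) u k)%:E.
Proof.
move=> wn sn u0; rewrite (@nneseries_eq_sum _ _ n.+1).
- rewrite -sumEFin; apply: eq_bigr => k _.
  by rewrite (still_waiting_indic k wn sn) -ltnS ltn_ord mul1r.
- by move=> k; rewrite lee_fin mulr_ge0.
- by move=> k nk; rewrite (still_waiting_indic k wn sn) leqNgt nk mul0r.
Qed.

(** Shifting the indicator drops the last term, leaving N_i terms instead of N_i + 1. *)
Lemma sum_still_waitingS n w (u : nat -> R) :
    still_waiting n w -> success n w -> (forall k, 0 <= u k)%R ->
  \sum_(k <oo) (\1_(still_waiting k.+1) w * u k)%:E = (\sum_(k < n) u k)%:E.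
Proof.
move=> wn sn u0; rewrite (@nneseries_eq_sum _ _ n).
- rewrite -sumEFin; apply: eq_bigr => k _.
  by rewrite (still_waiting_indic k.+1 wn sn) ltn_ord mul1r.
- by move=> k; rewrite lee_fin mulr_ge0.
- by move=> k nk; rewrite (still_waiting_indic k.+1 wn sn) ltnNge nk mul0r.
Qed.

(** The case of unit terms. The series is left unsummed, being the very factor that Wald's identity
    produces. *)
Lemma expectation_failed_visits :
  'E_P[fun w => (failed_visits c w)%:R%R] = \sum_(k <oo) P (still_waiting k.+1).
Proof.
rewrite -integral_indic_sum; last by move=> k; exact: measurable_still_waiting.
rewrite unlock; apply: ae_eq_integral => //.
- apply/measurable_EFinP.
  apply: (measurable_fun_nat_index (n := failed_visits c) (f := fun k => cst k%:R)) => //.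
  exact: measurable_failed_visits.
- apply: (measurable_indic_sum (u := fun _ => cst 1%R)) => // k.
  exact: measurable_still_waiting.
- apply: filterS ae_served => w [n wn sn] _.
  rewrite (failed_visits_success wn sn) (sum_still_waitingS (u := fun=> 1%R) wn sn)//.
  by rewrite sumr_const card_ord.
Qed.

Lemma expectation_failed_visitsS :
  'E_P[fun w => (failed_visits c w).+1%:R%R] = \sum_(k <oo) P (still_waiting k).
Proof.
rewrite -integral_indic_sum; last by move=> k; exact: measurable_still_waiting.
rewrite unlock; apply: ae_eq_integral => //.
- apply/measurable_EFinP.
  apply: (measurable_fun_nat_index (n := failed_visits c) (f := fun k => cst k.+1%:R)) => //.
  exact: measurable_failed_visits.
- apply: (measurable_indic_sum (u := fun _ => cst 1%R)) => // k.
  exact: measurable_still_waiting.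
- apply: filterS ae_served => w [n wn sn] _.
  rewrite (failed_visits_success wn sn) (sum_still_waiting (u := fun=> 1%R) wn sn)//.
  by rewrite sumr_const card_ord.
Qed.

(** * Random sums in the sojourn time *)

Lemma ae_cycle_time_except_ge0 : {ae P, forall w, (0 <= cycle_time_except Q i w)%R}.
Proof.
have V0 : {ae P, forall w, forall k, (0 < visit Q k w)%R}.
  by apply: filter_forall => k; exact: visit_gt0.
have D0 : {ae P, forall w, forall k, (0 <= switchover Q k w)%R}.
  by apply: filter_forall => k; exact: switchover_ge0.
(* The subtracted visit cancels against the term [i] of the cycle. *)
apply: filterS2 D0 V0 => w D0 V0; rewrite /cycle_time_except /cycle_time (bigD1 i)//=.
rewrite addrAC [X in (_ <= X - _ + _)%R]addrC addrK addr_ge0// sumr_ge0// => k _.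
by rewrite addr_ge0// ltW.
Qed.

Lemma ae_copies_ge0 : {ae P, forall w, forall k,
  [/\ 0 <= service_copy c k w, 0 <= visit_copy c k.+1 w & 0 <= cycle_copy c k.+1 w]%R}.
Proof.
have geE (Z Y : {RV P >-> R}) : same_law Z Y -> {ae P, forall w, (0 <= Y w)%R} ->
    {ae P, forall w, (0 <= Z w)%R}.
  move=> ZY Y0.
  have : {ae P, forall w, `[0%R, +oo[%classic (Z w)}.
    apply: (same_law_ae ZY); first exact: measurable_itv.
    by apply: filterS Y0 => w; rewrite /= in_itv/= andbT.
  by apply: filterS => w; rewrite /= in_itv/= andbT.
apply: ae_forall_nat => k.
have B0 := geE _ _ (service_copy_law c k) (service_ge0 Q i).
have C0 := geE _ _ (cycle_copy_law c (ltn0Sn k)) ae_cycle_time_except_ge0.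
have V0 := geE _ _ (visit_copy_law c (ltn0Sn k)) (filterS (fun w => @ltW _ _ 0%R _) (visit_gt0 Q i)).
near=> w; split; near: w; [exact: B0|exact: V0|exact: C0].
Unshelve. all: by end_near. Qed.

(** Time spent in full absences after an interrupted first service: N_i + 1 terms. *)
Let sum_cycles w : \bar R :=
  \sum_(k <oo) (\1_(still_waiting k) w * `|cycle_copy c k.+1 w|)%:E.

(** The same for an arrival outside the visits: N_i terms, since the residual absence precedes visit
    1. *)
Let sum_full_cycles w : \bar R :=
  \sum_(k <oo) (\1_(still_waiting k.+1) w * `|cycle_copy c k.+1 w|)%:E.

Let sum_services w : \bar R :=
  \sum_(k <oo) (\1_(still_waiting k) w *
    `|Num.min (service_copy c k.+1 w) (visit_copy c k.+1 w)|)%:E.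

Let m_norm_cycle k : measurable_fun setT (fun w => `|cycle_copy c k.+1 w|%R).
Proof. exact: measurableT_comp. Qed.

Let m_norm_service k : measurable_fun setT
  (fun w => `|Num.min (service_copy c k.+1 w) (visit_copy c k.+1 w)|%R).
Proof. by apply: measurableT_comp => //; exact: measurable_minr. Qed.

Lemma measurable_sums : [/\ measurable_fun setT sum_cycles,
  measurable_fun setT sum_full_cycles & measurable_fun setT sum_services].
Proof.
split.
- by apply: (measurable_indic_sum (u := fun k w => `|cycle_copy c k.+1 w|)%R);
    [exact: measurable_still_waiting|exact: m_norm_cycle|].
- by apply: (measurable_indic_sum (u := fun k w => `|cycle_copy c k.+1 w|)%R);
    [move=> k; exact: measurable_still_waiting|exact: m_norm_cycle|].
- by apply: (measurable_indic_sum (u := fun k w =>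
      `|Num.min (service_copy c k.+1 w) (visit_copy c k.+1 w)|)%R);
    [exact: measurable_still_waiting|exact: m_norm_service|].
Qed.

Lemma sums_ge0 w : [/\ 0 <= sum_cycles w, 0 <= sum_full_cycles w & 0 <= sum_services w].
Proof. by split; apply: nneseries_ge0 => k _ _; rewrite lee_fin mulr_ge0. Qed.

Lemma expectation_norm_cycle k :
  \int[P]_w `|cycle_copy c k.+1 w|%:E = 'E_P[cycle_time_except Q i].
Proof.
rewrite (same_law_integral (cycle_copy_law c (ltn0Sn k)) (h := fun x => `|x|%:E))//.
  by rewrite ae_expectation_norm//; exact: ae_cycle_time_except_ge0.
exact: measurable_norm_EFin.
Qed.

Let min_pair (z : R * R) := `|Num.min z.1 z.2|%R.

Let m_min_pair : measurable_fun setT min_pair.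
Proof. by apply: measurableT_comp => //; exact: measurable_minr. Qed.

Lemma expectation_norm_service k :
  \int[P]_w `|Num.min (service_copy c k.+1 w) (visit_copy c k.+1 w)|%:E =
  'E_P[fun w => Num.min (service Q i w) (visit Q i w)].
Proof.
rewrite (service_visit_copy_law k (h := fun z => (min_pair z)%:E)); first last.
- by move=> z; rewrite lee_fin /min_pair normr_ge0.
- by apply/measurable_EFinP; exact: m_min_pair.
rewrite -ae_expectation_norm//; first exact: measurable_minr.
have := service_ge0 Q i; have := visit_gt0 Q i; apply: filterS2 => w V0 B0.
by rewrite le_min B0 ltW.
Qed.

Section arrival_event.
Variable F : set T.
Hypothesis bF : block on_arrival F.

Let mF : measurable F. Proof. exact: block_measurable bF. Qed.

Lemma integral_sum_cycles : \int[P]_(w in F) sum_cycles w =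
  P F * ('E_P[fun w => (failed_visits c w).+1%:R%R] * 'E_P[cycle_time_except Q i]).
Proof.
rewrite expectation_failed_visitsS.
apply: (integral_stopped_sum (U := fun k w => `|cycle_copy c k.+1 w|%R)) => //.
- exact: measurable_still_waiting.
- move=> k E mE; apply: (independent_arrival_visits (@disjoint_cycle k k)) => //.
    exact: block_still_waiting.
  apply: sub_sigma_algebra; apply: (@cylinder_preimage _ _ _ _ X _ (CycleCopy k) ((fun x : R => `|x|%R) @^-1` E)) => //.
  by rewrite -[X in measurable X]setTI; exact: normr_measurable.
- exact: expectation_norm_cycle.
Qed.

(** A_{k+1} depends on the outcome of visit k + 1 but on no absence, so the shifted indicator is
    still independent of its term; for the services this would break down. *)
Lemma integral_sum_full_cycles : \int[P]_(w in F) sum_full_cycles w =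
  P F * ('E_P[fun w => (failed_visits c w)%:R%R] * 'E_P[cycle_time_except Q i]).
Proof.
rewrite expectation_failed_visits.
apply: (integral_stopped_sum (A := fun k => still_waiting k.+1)
  (U := fun k w => `|cycle_copy c k.+1 w|%R)) => //.
- by move=> k; exact: measurable_still_waiting.
- move=> k E mE; apply: (independent_arrival_visits (@disjoint_cycle k.+1 k)) => //.
    exact: block_still_waiting.
  apply: sub_sigma_algebra; apply: (@cylinder_preimage _ _ _ _ X _ (CycleCopy k) ((fun x : R => `|x|%R) @^-1` E)) => //.
  by rewrite -[X in measurable X]setTI; exact: normr_measurable.
- exact: expectation_norm_cycle.
Qed.

Lemma integral_sum_services : \int[P]_(w in F) sum_services w =
  P F * ('E_P[fun w => (failed_visits c w).+1%:R%R] *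
         'E_P[fun w => Num.min (service Q i w) (visit Q i w)]).
Proof.
rewrite expectation_failed_visitsS.
apply: (integral_stopped_sum (U := fun k w =>
  `|Num.min (service_copy c k.+1 w) (visit_copy c k.+1 w)|%R)) => //.
- exact: measurable_still_waiting.
- move=> k E mE; apply: (independent_arrival_visits (@disjoint_visit_number k)) => //.
    exact: block_still_waiting.
  apply: (@block_pair _ _ _ _ X _ (ServiceCopy k.+1) (VisitCopy k) (min_pair @^-1` E)); [by left|by right|].
  by rewrite -[X in measurable X]setTI; exact: m_min_pair.
- exact: expectation_norm_service.
Qed.

End arrival_event.

(** * The sojourn time split by arrival case *)

Lemma measurable_sojourn_time : measurable_fun setT (sojourn_time c).
Proof.
(* With the number of failed visits frozen at [n], finitely many measurable copies occur; the random
   index is restored by splitting along its countably many values. *)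
pose full n w := (\sum_(1 <= m < n.+1) (cycle_copy c m w + visit_copy c m w))%R.
pose S n w : R :=
  (if w \in during_visit c then
    if service_copy c 0 w <= residual_visit c w then service_copy c 0 w
    else residual_visit c w + full n w + cycle_copy c n.+1 w + service_copy c n.+1 w
  else residual_cycle c w + full n w + service_copy c n.+1 w)%R.
apply: (measurable_fun_nat_index (n := failed_visits c) (f := S)).
  exact: measurable_failed_visits.
move=> n.
have mfull : measurable_fun setT (full n).
  by apply: measurable_sum => m; exact: measurable_funD.
apply: measurable_fun_ifT.
- exact: measurable_in (measurable_during_visit c).
- apply: measurable_fun_ifT => //; first exact: measurable_fun_ler.
  by apply: measurable_funD => //; apply: measurable_funD => //; exact: measurable_funD.
- by apply: measurable_funD => //; exact: measurable_funD.
Qed.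

(** A version of the sojourn time nonnegative on every path, with waiting time regrouped into
    absences and time spent in visits. *)
Let sojourn w : \bar R :=
  if w \in during_visit c then
    if (service_copy c 0 w <= residual_visit c w)%R then `|service_copy c 0 w|%:E
    else `|residual_visit c w|%:E + (sum_cycles w + sum_services w)
  else `|residual_cycle c w|%:E + (sum_full_cycles w + sum_services w).

Lemma ae_sojourn_time : {ae P, forall w, (sojourn_time c w)%:E = sojourn w}.
Proof.
have Vr0 := residual_time_gt0 (residual_visit_law c).
have Cr0 := residual_time_gt0 (residual_cycle_law c).
have r0 : {ae P, forall w, (0 < residual_visit c w)%R /\ (0 < residual_cycle c w)%R}.
  by apply: filterS2 Vr0 Cr0 => w.
have sc : {ae P, forall w, (forall k, [/\ 0 <= service_copy c k w, 0 <= visit_copy c k.+1 w &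
    0 <= cycle_copy c k.+1 w]%R) /\ exists2 n, still_waiting n w & success n w}.
  by apply: filterS2 ae_copies_ge0 ae_served => w.
apply: filterS2 r0 sc => w [Vrw Crw] [ge0 [n wn sn]].
have B0 k : (0 <= service_copy c k w)%R by case: (ge0 k).
have V0 k : (0 <= visit_copy c k.+1 w)%R by case: (ge0 k).
have C0 k : (0 <= cycle_copy c k.+1 w)%R by case: (ge0 k).
have sumCE : sum_cycles w = (\sum_(k < n) cycle_copy c k.+1 w + cycle_copy c n.+1 w)%:E.
  rewrite /sum_cycles (sum_still_waiting (u := fun k => `|cycle_copy c k.+1 w|%R) wn sn)//.
  congr EFin; rewrite big_ord_recr/= ger0_norm//; congr (_ + _)%R.
  by apply: eq_bigr => k _; rewrite ger0_norm.
have sumFE : sum_full_cycles w = (\sum_(k < n) cycle_copy c k.+1 w)%:E.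
  rewrite /sum_full_cycles (sum_still_waitingS (u := fun k => `|cycle_copy c k.+1 w|%R) wn sn)//.
  by congr EFin; apply: eq_bigr => k _; rewrite ger0_norm.
have sumSE : sum_services w = (\sum_(k < n) visit_copy c k.+1 w + service_copy c n.+1 w)%:E.
  rewrite /sum_services (sum_still_waiting (u := fun k =>
    `|Num.min (service_copy c k.+1 w) (visit_copy c k.+1 w)|%R) wn sn)//.
  congr EFin; rewrite big_ord_recr/=; congr (_ + _)%R; last by rewrite min_l// ger0_norm.
  apply: eq_bigr => k _; rewrite min_r ?ger0_norm//.
  by have /negP := wn k (ltn_ord k); rewrite -ltNge => /ltW.
have fullE : (\sum_(1 <= m < n.+1) (cycle_copy c m w + visit_copy c m w) =
    \sum_(k < n) cycle_copy c k.+1 w + \sum_(k < n) visit_copy c k.+1 w)%R.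
  by rewrite big_add1/= big_mkord big_split.
rewrite /sojourn_time (failed_visits_success wn sn) fullE /sojourn sumCE sumFE sumSE.
rewrite -!EFinD (ger0_norm (B0 0%N)) (gtr0_norm Vrw) (gtr0_norm Crw).
case: ifPn => _; last by rewrite !addrA.
case: ifPn => // _; congr EFin; rewrite -!addrA; congr (_ + (_ + _))%R.
by rewrite addrCA.
Qed.

Let arrival_served : set T := [set w | (service_copy c 0 w <= residual_visit c w)%R].

Let b_served (A : set customer_index) :
  A (ServiceCopy 0) -> A ResidualVisit -> block A arrival_served.
Proof. by move=> A1 A2; have := @block_pair _ _ _ _ X A _ _ le_set A1 A2 m_le. Qed.

Let mD : measurable (during_visit c). Proof. exact: measurable_during_visit. Qed.

Let m_served : measurable arrival_served.
Proof. by apply: (@block_measurable setT); exact: b_served. Qed.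

Let mnorm (Z : {RV P >-> R}) : measurable_fun setT (fun w => `|Z w|%:E).
Proof. by apply/measurable_EFinP; exact: measurableT_comp. Qed.

Let m_sojourn : measurable_fun setT sojourn.
Proof.
have [mC mF mS] := measurable_sums.
apply: measurable_fun_ifT; first exact: measurable_in.
  apply: measurable_fun_ifT; [exact: measurable_fun_ler|exact: mnorm|].
  by apply: emeasurable_funD => //; exact: emeasurable_funD.
by apply: emeasurable_funD => //; exact: emeasurable_funD.
Qed.

Lemma integral_sojourn : \int[P]_w sojourn w =
  \int[P]_(w in during_visit c `&` arrival_served) `|service_copy c 0 w|%:E +
  (\int[P]_(w in during_visit c `&` ~` arrival_served) `|residual_visit c w|%:E +
   (\int[P]_(w in during_visit c `&` ~` arrival_served) sum_cycles w +
    \int[P]_(w in during_visit c `&` ~` arrival_served) sum_services w)) +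
  (\int[P]_(w in ~` during_visit c) `|residual_cycle c w|%:E +
   (\int[P]_(w in ~` during_visit c) sum_full_cycles w +
    \int[P]_(w in ~` during_visit c) sum_services w)).
Proof.
have [mC mF mS] := measurable_sums.
have s0 w : 0 <= sojourn w.
  have [? ? ?] := sums_ge0 w.
  rewrite /sojourn; case: ifP => _; last by rewrite !adde_ge0.
  by case: ifP => _; rewrite ?lee_fin// !adde_ge0.
have split3 (A : set T) (f g h : T -> \bar R) : measurable A ->
    measurable_fun setT f -> measurable_fun setT g -> measurable_fun setT h ->
    (forall w, 0 <= f w) -> (forall w, 0 <= g w) -> (forall w, 0 <= h w) ->
    \int[P]_(w in A) (f w + (g w + h w)) =
    \int[P]_(w in A) f w + (\int[P]_(w in A) g w + \int[P]_(w in A) h w).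
  move=> mA mf mg mh f0 g0 h0.
  rewrite ge0_integralD//; last 3 first.
  - exact: measurable_funTS.
  - by move=> w _; exact: adde_ge0.
  - by apply: measurable_funTS; exact: emeasurable_funD.
  by rewrite ge0_integralD//; exact: measurable_funTS.
have mDS : measurable (during_visit c `&` arrival_served) by exact: measurableI.
have mDF : measurable (during_visit c `&` ~` arrival_served).
  by apply: measurableI => //; exact: measurableC.
have mO : measurable (~` during_visit c) by exact: measurableC.
have C0 w : 0 <= sum_cycles w by have [] := sums_ge0 w.
have F0 w : 0 <= sum_full_cycles w by have [] := sums_ge0 w.
have S0 w : 0 <= sum_services w by have [] := sums_ge0 w.
rewrite -(split3 _ _ _ _ mDF)// -(split3 _ _ _ _ mO)//.
rewrite -[X in integral _ X](setUv (during_visit c)) ge0_integral_setU//; last 2 first.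
- exact: measurable_funTS.
- by rewrite disj_set2E setICr.
rewrite -{1}(setIT (during_visit c)) -(setUv arrival_served) setIUr ge0_integral_setU//; last 2 first.
- exact: measurable_funTS.
- by rewrite disj_set2E setIACA setICr setI0.
congr (_ + _ + _); apply: eq_integral => w; rewrite /sojourn ?in_setI ?in_setC.
- by move=> /andP[->]; rewrite inE => ->.
- by move=> /andP[->]; rewrite notin_setE/= => /negP/negbTE ->.
- by move=> /negbTE ->.
Qed.

(** * Transfer to the service time and residual visit of the formula *)

Variables (Vres : {RV P >-> R}).
Hypothesis hVres : residual_time (visit Q i) Vres.
Hypothesis hind : independent2 P Vres (service Q i).

(** [Vres] and the customer's [residual_visit] are distinct variables; uniqueness of the residual
    law and independence from the service on each side identify the pairs in law. *)
Lemma arrival_pair_law (h : R * R -> \bar R) :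
    measurable_fun setT h -> (forall z, 0 <= h z) ->
  \int[P]_w h (service_copy c 0 w, residual_visit c w) =
  \int[P]_w h (service Q i w, Vres w).
Proof.
move=> mh h0; apply: eq_joint_law => //.
- exact: service_copy_law.
- exact: residual_time_same_law (residual_visit_law c) hVres.
- by move=> A B; apply: (independent_pair indX (j := ServiceCopy 0) (k := ResidualVisit)).
(* In [independent2] the boolean [true] names [Vres] and [false] the service. *)
- by move=> A B; apply: (independent_pair hind (j := false) (k := true)).
Qed.

Lemma integral_during_visit (h : R * R -> R) :
    measurable_fun setT h -> (forall z, 0 <= h z)%R ->
  \int[P]_(w in during_visit c) (h (service_copy c 0 w, residual_visit c w))%:E =
  P (during_visit c) * \int[P]_w (h (service Q i w, Vres w))%:E.
Proof.
move=> mh h0; rewrite -(arrival_pair_law (h := EFin \o h)) /=; last 2 first.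
- exact/measurable_EFinP.
- by move=> z; rewrite lee_fin.
apply: ge0_integral_independent => //.
  by apply: measurableT_comp => //; exact: measurable_fun_pair.
move=> E mE.
apply: (independent_blocks mX indX (A := [set ArrivalDuringVisit]) (A' := [set ServiceCopy 0; ResidualVisit])).
- by rewrite -subset0 => j [/= -> []].
- exact: block_during_visit.
- apply: (@block_pair _ _ _ _ X _ (ServiceCopy 0) ResidualVisit (h @^-1` E)); [by left|by right|].
  by rewrite -[X in measurable X]setTI; exact: mh.
Qed.

Lemma prob_arrival_served : P arrival_served = P [set w | (service Q i w <= Vres w)%R].
Proof.
rewrite /arrival_served !prob_le//.
apply: (arrival_pair_law (h := fun z => (\1_le_set z)%:E)) => //.
exact/measurable_EFinP/measurable_indic.
Qed.

Let B : {RV P >-> R} := service Q i.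
Let V : {RV P >-> R} := visit Q i.

Let BleVres : set T := [set w | (B w <= Vres w)%R].

Let m_BleVres : measurable BleVres.
Proof.
have := measurable_fun_pair (measurable_funPT B) (measurable_funPT Vres) measurableT m_le.
by rewrite setTI.
Qed.

Let m_norm1 (S : set (R * R)) : measurable S ->
  measurable_fun setT (fun z : R * R => (`|z.1| * \1_S z)%R).
Proof.
move=> mS; apply: measurable_funM; last exact: measurable_indic.
by apply: measurableT_comp => //; exact: measurable_fst.
Qed.

Let m_norm2 (S : set (R * R)) : measurable S ->
  measurable_fun setT (fun z : R * R => (`|z.2| * \1_S z)%R).
Proof.
move=> mS; apply: measurable_funM; last exact: measurable_indic.
by apply: measurableT_comp => //; exact: measurable_snd.
Qed.

(** The event {B <= Vres} is moved into the integrand as an indicator, which leaves a function of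
    the pair alone. *)
Lemma integral_arrival_served :
  \int[P]_(w in during_visit c `&` arrival_served) `|service_copy c 0 w|%:E =
  P (during_visit c) * (P BleVres * 'E_P[B | BleVres]).
Proof.
rewrite mule_cond_expectation// -ae_integral_norm//; last exact: service_ge0.
rewrite -integral_mul_indic -[in RHS](setTI BleVres) -[in RHS]integral_mul_indic.
exact: (integral_during_visit (h := fun z => `|z.1| * \1_le_set z)%R (m_norm1 m_le)).
Qed.

Lemma integral_arrival_interrupted :
  \int[P]_(w in during_visit c `&` ~` arrival_served) `|residual_visit c w|%:E =
  P (during_visit c) * (P (~` BleVres) * 'E_P[Vres | ~` BleVres]).
Proof.
have mC : measurable (~` BleVres) by exact: measurableC.
rewrite mule_cond_expectation// -ae_integral_norm//; last first.
  by apply: filterS (residual_time_gt0 hVres) => w /ltW.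
rewrite -integral_mul_indic -[in RHS](setTI (~` _)) -[in RHS]integral_mul_indic.
exact: (integral_during_visit (h := fun z => `|z.2| * \1_(~` le_set) z)%R (m_norm2 (measurableC m_le))).
Qed.

Lemma prob_arrival_interrupted :
  P (during_visit c `&` ~` arrival_served) = P (during_visit c) * P (~` BleVres).
Proof.
rewrite [in RHS]probability_setC// -prob_arrival_served -probability_setC//.
apply: (independent_blocks mX indX (A := [set ArrivalDuringVisit]) (A' := [set ServiceCopy 0; ResidualVisit])).
- by rewrite -subset0 => j [/= -> []].
- exact: block_during_visit.
- by apply: block_setC; apply: b_served; [left|right].
Qed.

Lemma integral_residual_cycle :
  \int[P]_(w in ~` during_visit c) `|residual_cycle c w|%:E =
  P (~` during_visit c) * ('E_P[fun w => (cycle_time_except Q i w ^+ 2)%R] /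
    (2%:E * 'E_P[cycle_time_except Q i])).
Proof.
have Cr0 : {ae P, forall w, (0 <= residual_cycle c w)%R}.
  by apply: filterS (residual_time_gt0 (residual_cycle_law c)) => w /ltW.
rewrite -(residual_time_expectation (residual_cycle_law c) ae_cycle_time_except_ge0).
rewrite -ae_expectation_norm//; apply: ge0_integral_independent => //.
- exact: measurableC.
- exact: measurableT_comp.
move=> E mE.
apply: (independent_blocks mX indX (A := [set ArrivalDuringVisit]) (A' := [set ResidualCycle])).
- by rewrite -subset0 => j [/= ->].
- by apply: block_setC; exact: block_during_visit.
- apply: sub_sigma_algebra.
  apply: (@cylinder_preimage _ _ _ _ X _ ResidualCycle ((fun x : R => `|x|%R) @^-1` E)) => //.
  by rewrite -[X in measurable X]setTI; exact: normr_measurable.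
Qed.

Theorem expectation_sojourn_time :
  let C := cycle_time Q in
  let Cexc := cycle_time_except Q i in
  let Ni := failed_visits c in
  let EN := 'E_P[fun w => (Ni w)%:R%R] in
  let EN1 := 'E_P[fun w => (Ni w).+1%:R%R] in
  let Emin := 'E_P[fun w => Num.min (B w) (V w)] in
  'E_P[sojourn_time c] =
    'E_P[V] / 'E_P[C] * P [set w | (B w <= Vres w)%R]
      * 'E_P[B | [set w | (B w <= Vres w)%R]]
    + 'E_P[V] / 'E_P[C] * P [set w | (Vres w < B w)%R]
      * ('E_P[Vres | [set w | (Vres w < B w)%R]] + EN1 * ('E_P[Cexc] + Emin))
    + 'E_P[Cexc] / 'E_P[C]
      * ('E_P[fun w => (Cexc w ^+ 2)%R] / (2%:E * 'E_P[Cexc])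
         + EN * 'E_P[Cexc] + EN1 * Emin).
Proof.
move=> C Cexc Ni EN EN1 Emin.
have ltE : [set w | (Vres w < B w)%R] = ~` BleVres.
  by apply/seteqP; split=> w /=; rewrite ltNge => /negP.
rewrite ltE -/BleVres.
have mC : measurable (~` BleVres) by exact: measurableC.
rewrite -(during_visit_prob c) -(outside_visit_prob c).
have bF2 : block on_arrival (during_visit c `&` ~` arrival_served).
  apply: block_setI; first by apply: block_during_visit; left.
  by apply: block_setC; apply: b_served; right; [left|right; left].
have bF3 : block on_arrival (~` during_visit c).
  by apply: block_setC; apply: block_during_visit; left.
have -> : 'E_P[sojourn_time c] = \int[P]_w sojourn w.
  rewrite unlock; apply: ae_eq_integral => //.
  - by apply/measurable_EFinP; exact: measurable_sojourn_time.
  - by apply: filterS ae_sojourn_time => w + _.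
rewrite integral_sojourn integral_arrival_served integral_arrival_interrupted.
rewrite integral_residual_cycle (integral_sum_cycles bF2) (integral_sum_services bF2).
rewrite (integral_sum_full_cycles bF3) (integral_sum_services bF3).
rewrite prob_arrival_interrupted.
(* Distributivity over sums in the extended reals is used below only for nonnegative summands. *)
have EC0 : 0 <= 'E_P[Cexc].
  by rewrite -(expectation_norm_cycle 0); apply: integral_ge0 => w _; rewrite lee_fin.
have Emin0 : 0 <= Emin.
  by rewrite /Emin -(expectation_norm_service 0); apply: integral_ge0 => w _; rewrite lee_fin.
have EN0 : 0 <= EN by rewrite /EN unlock; apply: integral_ge0 => w _; rewrite lee_fin.
have EN10 : 0 <= EN1 by rewrite /EN1 unlock; apply: integral_ge0 => w _; rewrite lee_fin.
have EV0 : 0 <= 'E_P[Vres | ~` BleVres].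
  apply: mule_ge0; last by rewrite inve_ge0.
  rewrite -ae_integral_norm//; last by apply: filterS (residual_time_gt0 hVres) => w /ltW.
  by apply: integral_ge0 => w _; rewrite lee_fin.
have ECr0 : 0 <= 'E_P[fun w => (Cexc w ^+ 2)%R] / (2%:E * 'E_P[Cexc]).
  apply: mule_ge0; last by rewrite inve_ge0 mule_ge0// lee_fin.
  by rewrite unlock; apply: integral_ge0 => w _; rewrite lee_fin sqr_ge0.
have ENC0 : 0 <= EN * 'E_P[Cexc] by exact: mule_ge0.
have EN1C0 : 0 <= EN1 * 'E_P[Cexc] by exact: mule_ge0.
have EN1M0 : 0 <= EN1 * Emin by exact: mule_ge0.
rewrite (ge0_muleDr EN1 EC0 Emin0) (ge0_muleDr _ EV0 (adde_ge0 EN1C0 EN1M0)).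
rewrite (ge0_muleDr (_ * _) EN1C0 EN1M0).
rewrite (ge0_muleDr _ (adde_ge0 ECr0 ENC0) EN1M0) (ge0_muleDr _ ECr0 ENC0).
by rewrite !muleA !addeA.
Qed.

End tagged_customer.

Theorem mainTheorem5 (d : measure_display) (T : measurableType d)
    (R : realType) (P : probability T R) (N : nat) (hN : (2 <= N)%N)
    (Q : polling_system P N) (i : 'I_N) (hp : 0 < completion_prob Q i)
    (c : tagged_customer Q i)
    (Vres : {RV P >-> R}) (hVres : residual_time (visit Q i) Vres)
    (hind : independent2 P Vres (service Q i)) :
  let B := service Q i in
  let V := visit Q i in
  let C := cycle_time Q in
  let Cexc := cycle_time_except Q i in
  let p := completion_prob Q i in
  let Ni := failed_visits c in
  let EN := 'E_P[fun w => (Ni w)%:R%R] in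
  let EN1 := 'E_P[fun w => (Ni w).+1%:R%R] in
  let Emin := 'E_P[fun w => Num.min (B w) (V w)] in
  (forall m : nat, P [set w | Ni w = m] = (1 - p) ^+ m * p) /\
  'E_P[sojourn_time c] =
    'E_P[V] / 'E_P[C] * P [set w | (B w <= Vres w)%R]
      * 'E_P[B | [set w | (B w <= Vres w)%R]]
    + 'E_P[V] / 'E_P[C] * P [set w | (Vres w < B w)%R]
      * ('E_P[Vres | [set w | (Vres w < B w)%R]] + EN1 * ('E_P[Cexc] + Emin))
    + 'E_P[Cexc] / 'E_P[C]
      * ('E_P[fun w => (Cexc w ^+ 2)%R] / (2%:E * 'E_P[Cexc])
         + EN * 'E_P[Cexc] + EN1 * Emin).
Proof.
move=> B V C Cexc p Ni EN EN1 Emin; split.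
  exact: prob_failed_visits.
exact: expectation_sojourn_time.
Qed.
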